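(* Consider the intercept-only cluster model of the context, under the null $\theta=E[\sum_{i=1}^{N_g}Y_{gi}]=0$. Suppose $(N_g,\sum_{i=1}^{N_g}Y_{gi})$ are i.i.d. across $g$, $E[N_g]=c\in(0,\infty)$, and $N_g$ and $\sum_{i=1}^{N_g}Y_{gi}$ belong to the domain of attraction of stable laws with a common index $\alpha\in(1,2)$. Then the wild cluster bootstrap with Rademacher weights is inconsistent, i.e. it is not true that $$\sup_{t\in\mathbb R}\big|P(T_G^*\le t\mid Y_{1:G})-P(T_G\le t)\big|\xrightarrow{p}0\quad\text{as }G\to\infty.$$
   Context: Clusters $g=1,\dots,G$ have random sizes $N_g\ge1$ and scalar observations $Y_{gi}$, $i=1,\dots,N_g$; $N=\sum_g N_g$; $Y_{1:G}$ denotes all observations. Define $\hat\theta=N^{-1}\sum_g\sum_i Y_{gi}$ and $T_G=\dfrac{\sum_{g=1}^G\sum_{i=1}^{N_g}Y_{gi}}{\sqrt{\sum_{g=1}^G(\sum_{i=1}^{N_g}(Y_{gi}-\hat\theta))^2}}$. Let $v_1^*,\dots,v_G^*$ be i.i.d. Rademacher variables ($\pm1$ with probability $1/2$ each), independent of the data; $\hat\theta^*=N^{-1}\sum_g v_g^*\sum_i Y_{gi}$ and $T_G^*=\dfrac{\sum_{g=1}^G v_g^*\sum_{i=1}^{N_g}Y_{gi}}{\sqrt{\sum_{g=1}^G(v_g^*\sum_{i=1}^{N_g}(Y_{gi}-\hat\theta^* ))^2}}$. Domain of attraction: a real random variable $\xi$ belongs to the domain of attraction of a stable law with index $\alpha\in(0,2]$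 if, for i.i.d. copies $\xi_1,\xi_2,\dots$, there exist $A_G>0$, $D_G\in\mathbb R$ with $(\sum_{g=1}^G\xi_g-D_G)/A_G$ converging in distribution to a nondegenerate random variable, where $A_G=G^{1/\alpha}L(G)$ for a function $L$ slowly varying at $\infty$. *)

(* Defs.v *)
From HB Require Import structures.
From mathcomp Require Import all_boot all_order all_algebra.
From mathcomp Require Import all_classical all_reals all_analysis.
Set Implicit Arguments. Unset Strict Implicit. Unset Printing Implicit Defensive.
Import Order.TTheory GRing.Theory Num.Theory numFieldNormedType.Exports.
Local Open Scope classical_set_scope.
Local Open Scope ring_scope.

(* Clusters g = 0..G-1 (the paper's g = 1..G), observations Y g i, i < N g. *)

Definition clusterT (R : realType) (Omega : Type) (N : nat -> Omega -> nat)
  (Y : nat -> nat -> Omega -> R) (G : nat) (w : Omega) : R :=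
  let Ntot : R := (\sum_(g < G) N g w)%:R in
  let thetahat := (\sum_(g < G) \sum_(i < N g w) Y g i w) / Ntot in
  (\sum_(g < G) \sum_(i < N g w) Y g i w) /
    Num.sqrt (\sum_(g < G) (\sum_(i < N g w) (Y g i w - thetahat)) ^+ 2).

Definition clusterTstar (R : realType) (Omega : Type) (N : nat -> Omega -> nat)
  (Y : nat -> nat -> Omega -> R) (G : nat) (v : 'I_G -> R) (w : Omega) : R :=
  let Ntot : R := (\sum_(g < G) N g w)%:R in
  let thetastar := (\sum_(g < G) v g * \sum_(i < N g w) Y g i w) / Ntot in
  (\sum_(g < G) v g * \sum_(i < N g w) Y g i w) /
    Num.sqrt (\sum_(g < G) (v g * \sum_(i < N g w) (Y g i w - thetastar)) ^+ 2).
Arguments clusterTstar {R Omega} N Y G v w.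

Definition rad (R : realType) (b : bool) : R := if b then 1 else -1.

(* P(T*_G <= t | Y_{1:G}) at the data point w: since v_1..v_G are i.i.d.
   Rademacher and independent of the data, the conditional law is the uniform
   average over the 2^G sign vectors. *)
Definition boot_cdf (R : realType) (Omega : Type) (N : nat -> Omega -> nat)
  (Y : nat -> nat -> Omega -> R) (G : nat) (w : Omega) (t : R) : R :=
  #|[set b : {ffun 'I_G -> bool} |
      clusterTstar N Y G (fun g => rad R (b g)) w <= t]|%:R / 2 ^+ G.

Definition iid_pairs d (Omega : measurableType d) (R : realType)
  (P : probability Omega R) (X : nat -> Omega -> (R * R)%type) : Prop :=
  (forall g, measurable_fun setT (X g)) /\
  (forall (J : seq nat) (B : nat -> set (R * R)), uniq J ->
     (forall j, measurable (B j)) ->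
     P (\bigcap_(j in [set` J]) (X j @^-1` B j)) =
       (\prod_(j <- J) P (X j @^-1` B j))%E) /\
  (forall g (B : set (R * R)), measurable B ->
     P (X g @^-1` B) = P (X 0%N @^-1` B)).

Definition distribution_function (R : realType) (F : R -> R) : Prop :=
  {homo F : x y / x <= y} /\
  (forall x, F y @[y --> x^'+] --> F x) /\
  F x @[x --> -oo] --> (0 : R) /\
  F x @[x --> +oo] --> (1 : R).

Definition nondegenerate (R : realType) (F : R -> R) : Prop :=
  exists x, 0 < F x < 1.

Definition cvg_in_distribution d (Omega : measurableType d) (R : realType)
  (P : probability Omega R) (Z : nat -> Omega -> R) (F : R -> R) : Prop :=
  forall x, {for x, continuous F} ->
    (fun n => fine (P [set w | Z n w <= x])) @ \oo --> F x.

Definition slowly_varying (R : realType) (L : R -> R) : Prop :=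
  measurable_fun setT L /\
  (\forall x \near +oo, 0 < L x) /\
  (forall lam, 0 < lam -> L (lam * x) / L x @[x --> +oo] --> (1 : R)).

(* The common law of the i.i.d. copies X 0, X 1, ... belongs to the domain of
   attraction of a stable law of index alpha in (0,2]. *)
Definition stable_DOA d (Omega : measurableType d) (R : realType)
  (P : probability Omega R) (X : nat -> Omega -> R) (alpha : R) : Prop :=
  0 < alpha <= 2 /\
  exists (A D : nat -> R) (L : R -> R) (F : R -> R),
    slowly_varying L /\
    (forall G, (0 < G)%N -> 0 < A G /\ A G = G%:R `^ alpha^-1 * L G%:R) /\
    distribution_function F /\ nondegenerate F /\
    cvg_in_distribution P (fun G w => (\sum_(g < G) X g w - D G) / A G) F.

(* Main.v *)
(** Write [S_g] for the cluster sums, [U] for the sum of the [S_g ^ 2] and [kurt]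
    for the ratio of the sum of the [S_g ^ 4] to [U ^ 2].  Since [max N_g] is
    negligible before [sum N_g], the bootstrap law is close to that of the
    Rademacher sum [sum v_g S_g / sqrt U], whose fourth moment is [3 - 2 kurt].
    Consistency would make the bootstrap law, hence [kurt], asymptotically
    deterministic.  Compare the first [G] clusters with the next [G]: with
    [U1], [U2] the two block values of [U],
    [kurt_2G (U1 + U2) ^ 2 = kurt_1 U1 ^ 2 + kurt_2 U2 ^ 2].
    If [kurt] does not tend to [0], this determines [U1 / U2], which must then be
    close to [1] because independent copies are close to each other with positive
    probability; if [kurt] tends to [0], exchanging the two blocks cluster by cluster
    and Chebyshev's inequality give [U1 / U2 -> 1] again.  Thus [U] doubles
    when [G] doubles.  But [U] is of the exact order [A_G ^ 2], with [A_G] the norming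
    of the domain of attraction, and [A_2G ^ 2 / A_G ^ 2] tends to
    [2 ^ (2 / alpha) > 2]. *)
From HB Require Import structures.
From mathcomp Require Import all_boot all_order all_algebra.
From mathcomp Require Import all_classical all_reals all_analysis.
From mathcomp Require Import measurable_realfun ring lra zify.
Require Import Defs.
Import Order.TTheory GRing.Theory Num.Theory numFieldNormedType.Exports.
Local Open Scope classical_set_scope.
Local Open Scope ring_scope.

(** * Rademacher sums and the bootstrap distribution function *)

Section SignSums.
Variable R : realType.
Implicit Types (a s m : nat -> R) (n : nat).

Definition sign_sum n a (b : {ffun 'I_n -> bool}) : R :=
  \sum_(i < n) rad R (b i) * a i.

Definition sign_mean n (f : {ffun 'I_n -> bool} -> R) : R :=
  (\sum_b f b) / 2 ^+ n.

Definition ffun_rcons n (p : {ffun 'I_n -> bool} * bool) : {ffun 'I_n.+1 -> bool} :=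
  [ffun i => if unlift ord_max i is Some j then p.1 j else p.2].

Definition ffun_belast n (b : {ffun 'I_n.+1 -> bool}) :=
  ([ffun i => b (lift ord_max i)] : {ffun 'I_n -> bool}, b ord_max).

Lemma ffun_rconsK n : cancel (@ffun_rcons n) (@ffun_belast n).
Proof.
case=> b e; rewrite /ffun_belast /ffun_rcons; congr pair.
  by apply/ffunP => i; rewrite !ffunE liftK.
by rewrite ffunE unlift_none.
Qed.

Lemma ffun_belastK n : cancel (@ffun_belast n) (@ffun_rcons n).
Proof.
move=> b; apply/ffunP => i; rewrite ffunE /=.
by case: unliftP => [j|] ->; rewrite ?ffunE.
Qed.

Lemma sign_sum_rcons n a b e :
  sign_sum n.+1 a (ffun_rcons n (b, e)) = sign_sum n a b + rad R e * a n.
Proof.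
rewrite /sign_sum big_ord_recr /=; congr (_ + _).
  apply: eq_bigr => i _; rewrite ffunE.
  have -> : widen_ord (leqnSn n) i = lift ord_max i.
    by apply: val_inj; rewrite /= /bump leqNgt ltn_ord.
  by rewrite liftK.
by rewrite ffunE unlift_none.
Qed.

Lemma sum_sign_sumS n a (f : R -> R) :
  \sum_(b : {ffun 'I_n.+1 -> bool}) f (sign_sum n.+1 a b) =
  \sum_(b : {ffun 'I_n -> bool})
    (f (sign_sum n a b + a n) + f (sign_sum n a b - a n)).
Proof.
rewrite (reindex (@ffun_rcons n)) /=; last first.
  exists (@ffun_belast n) => x _; [exact: ffun_rconsK|exact: ffun_belastK].
rewrite (eq_bigr (fun p => f (sign_sum n a p.1 + rad R p.2 * a n))); last first.
  by case=> b e _; rewrite sign_sum_rcons.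
rewrite -(pair_bigA _ (fun b e => f (sign_sum n a b + rad R e * a n))) /=.
apply: eq_bigr => b _; rewrite big_bool /rad /= mul1r mulN1r.
by [].
Qed.

Lemma sum_sign_const n (c : R) : \sum_(b : {ffun 'I_n -> bool}) c = 2 ^+ n * c.
Proof.
by rewrite sumr_const card_ffun card_bool card_ord -[LHS]mulr_natl natrX.
Qed.

Lemma sum_sign_ord0 a (f : R -> R) :
  \sum_(b : {ffun 'I_0 -> bool}) f (sign_sum 0 a b) = f 0.
Proof.
rewrite (eq_bigr (fun=> f 0)); last by move=> b _; rewrite /sign_sum big_ord0.
by rewrite sum_sign_const expr0 mul1r.
Qed.

Lemma sum_sign_sqr n a :
  \sum_(b : {ffun 'I_n -> bool}) sign_sum n a b ^+ 2 =
  2 ^+ n * \sum_(i < n) a i ^+ 2.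
Proof.
elim: n => [|n IH]; first by rewrite (sum_sign_ord0 a (fun x => x ^+ 2)) big_ord0 /=; ring.
rewrite (sum_sign_sumS n a (fun x => x ^+ 2)) big_ord_recr /=.
rewrite (eq_bigr (fun b => 2 * sign_sum n a b ^+ 2 + 2 * a n ^+ 2)); last first.
  by move=> b _; ring.
by rewrite big_split /= -big_distrr /= IH sum_sign_const [2 ^+ n.+1]exprS; ring.
Qed.

(** Only paired indices survive: three pairings contribute the squared sum of squares each, and the
    diagonal, counted three times instead of once, is corrected by -2. *)
Lemma sum_sign_pow4 n a :
  \sum_(b : {ffun 'I_n -> bool}) sign_sum n a b ^+ 4 =
  2 ^+ n * (3 * (\sum_(i < n) a i ^+ 2) ^+ 2 - 2 * \sum_(i < n) a i ^+ 4).
Proof.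
elim: n => [|n IH]; first by rewrite (sum_sign_ord0 a (fun x => x ^+ 4)) !big_ord0 /=; ring.
rewrite (sum_sign_sumS n a (fun x => x ^+ 4)) !big_ord_recr /=.
rewrite (eq_bigr (fun b => 2 * sign_sum n a b ^+ 4 +
  12 * a n ^+ 2 * sign_sum n a b ^+ 2 + 2 * a n ^+ 4)); last first.
  by move=> b _; ring.
rewrite !big_split /= -!big_distrr /= IH sum_sign_sqr sum_sign_const [2 ^+ n.+1]exprS.
ring.
Qed.

(** The constant 15 counts the pairings of six indices, as for a Gaussian sixth moment. The bound
    serves to cut off large values uniformly. *)
Lemma sum_sign_pow6 n a :
  \sum_(b : {ffun 'I_n -> bool}) sign_sum n a b ^+ 6 <=
  2 ^+ n * (15 * (\sum_(i < n) a i ^+ 2) ^+ 3).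
Proof.
elim: n => [|n IH].
  by rewrite (sum_sign_ord0 a (fun x => x ^+ 6)) !big_ord0 !expr0n /= !mulr0.
rewrite (sum_sign_sumS n a (fun x => x ^+ 6)) !big_ord_recr /=.
rewrite (eq_bigr (fun b => 2 * sign_sum n a b ^+ 6 +
  30 * a n ^+ 2 * sign_sum n a b ^+ 4 + 30 * a n ^+ 4 * sign_sum n a b ^+ 2
  + 2 * a n ^+ 6)); last by move=> b _; ring.
rewrite !big_split /= sum_sign_const -!big_distrr /= sum_sign_pow4 sum_sign_sqr [2 ^+ n.+1]exprS.
set U := \sum_(i < n) a i ^+ 2 in IH *; set Q := \sum_(i < n) a i ^+ 4.
have U0 : 0 <= U by apply: sumr_ge0 => i _; exact: sqr_ge0.
have Q0 : 0 <= Q by apply: sumr_ge0 => i _; rewrite exprn_even_ge0.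
have p0 : 0 < 2 ^+ n :> R by rewrite exprn_gt0.
have b0 : 0 <= a n ^+ 2 by exact: sqr_ge0.
rewrite (_ : a n ^+ 4 = (a n ^+ 2) ^+ 2); last by ring.
rewrite (_ : a n ^+ 6 = (a n ^+ 2) ^+ 3); last by ring.
move: (a n ^+ 2) b0 => t t0.
have h1 : 0 <= 2 ^+ n * (t * Q) by apply: mulr_ge0; [exact: ltW|exact: mulr_ge0].
have h2 : 0 <= 2 ^+ n * (t ^+ 2 * U) by apply: mulr_ge0; [exact: ltW|apply: mulr_ge0 => //; exact: sqr_ge0].
have h3 : 0 <= 2 ^+ n * t ^+ 3 by apply: mulr_ge0; [exact: ltW|exact: exprn_ge0].
move: IH; set I6 := \sum_b _ => IH.
have := ler_pM2l (ltr0n R 2) I6 (2 ^+ n * (15 * U ^+ 3)).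
rewrite IH => /esym h4.
nra.
Qed.

(** * Sums of squares, the ratio [kurt], and perturbation of the denominator *)

Definition sqsum n s : R := \sum_(i < n) s i ^+ 2.
Definition quartsum n s : R := \sum_(i < n) s i ^+ 4.

Definition kurt n s : R := quartsum n s / sqsum n s ^+ 2.

(** With [m] the cluster sizes, this is the factor by which recentring at the estimated mean
    perturbs the denominator, see [sqsum_shift]; it is at most the share of the largest cluster in
    the total size. *)
Definition cv2 n m : R := sqsum n m / (\sum_(i < n) m i) ^+ 2.

(** Common squared denominator of both statistics: [x] is the total of the cluster sums for
    [clusterT] and the sign sum for [clusterTstar], whose outer signs disappear on squaring. *)
Definition resid n s m (x : R) : R :=
  \sum_(i < n) (s i - m i * (x / \sum_(i < n) m i)) ^+ 2.

Definition tratio n s m (x : R) : R := x / Num.sqrt (resid n s m x).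

Lemma sqsum_ge0 n s : 0 <= sqsum n s.
Proof. by apply: sumr_ge0 => i _; exact: sqr_ge0. Qed.

Lemma quartsum_ge0 n s : 0 <= quartsum n s.
Proof. by apply: sumr_ge0 => i _; rewrite exprn_even_ge0. Qed.

Lemma resid_ge0 n s m x : 0 <= resid n s m x.
Proof. by apply: sumr_ge0 => i _; exact: sqr_ge0. Qed.

Lemma sqsum_shift n m x :
  \sum_(i < n) (m i * (x / \sum_(i < n) m i)) ^+ 2 = cv2 n m * x ^+ 2.
Proof.
rewrite /cv2 /sqsum (eq_bigr (fun i : 'I_n => m i ^+ 2 * (x / \sum_(i < n) m i) ^+ 2)).
  by rewrite -big_distrl /= exprMn exprVn; ring.
by move=> i _; rewrite exprMn.
Qed.

(** Young's inequality [2 |s y| <= e s^2 + y^2 / e], termwise. The hypothesis is of order [e ^+ 2]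
    so that division by [e] still leaves an error of order [e]. *)
Lemma resid_bounds n s m x e : 0 < e <= 1/3 ->
  cv2 n m * x ^+ 2 <= e ^+ 2 * sqsum n s ->
  (1 - 2 * e) * sqsum n s <= resid n s m x <= (1 + 3 * e) * sqsum n s.
Proof.
move=> /andP[e0 e3] h; rewrite -sqsum_shift in h.
set y := fun i : 'I_n => m i * (x / \sum_(i < n) m i) in h *.
have eV : e * e^-1 = 1 by rewrite mulfV// gt_eqF.
have eV0 : 0 < e^-1 by rewrite invr_gt0.
have hY : \sum_(i < n) y i ^+ 2 * e^-1 <= e * sqsum n s.
  rewrite -big_distrl /= ler_pdivrMr//; apply: le_trans h _.
  by rewrite le_eqVlt; apply/orP; left; apply/eqP; ring.
have h' : \sum_(i < n) y i ^+ 2 <= e * sqsum n s.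
  apply: (le_trans h); rewrite ler_wpM2r ?sqsum_ge0// expr2 ler_piMr// ?ltW//.
  by apply: le_lt_trans e3 _; lra.
rewrite /resid -/y; apply/andP; split.
  have : \sum_(i < n) ((1 - e) * s i ^+ 2 - y i ^+ 2 * e^-1) <=
      \sum_(i < n) (s i - y i) ^+ 2.
    apply: ler_sum => i _.
    have := sqr_ge0 (e * s i - y i) => hh.
    have := mulr_ge0 hh (ltW eV0).
    rewrite (_ : (e * s i - y i) ^+ 2 * e^-1 = (e * e^-1) * e * s i ^+ 2
      - 2 * (e * e^-1) * (s i * y i) + y i ^+ 2 * e^-1); last by ring.
    rewrite eV; have := sqr_ge0 (y i); nra.
  rewrite sumrB -big_distrr /= -/(sqsum n s); lra.
have : \sum_(i < n) (s i - y i) ^+ 2 <=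
    \sum_(i < n) ((1 + e) * s i ^+ 2 + y i ^+ 2 + y i ^+ 2 * e^-1).
  apply: ler_sum => i _.
  have := sqr_ge0 (e * s i + y i) => hh.
  have := mulr_ge0 hh (ltW eV0).
  rewrite (_ : (e * s i + y i) ^+ 2 * e^-1 = (e * e^-1) * e * s i ^+ 2
    + 2 * (e * e^-1) * (s i * y i) + y i ^+ 2 * e^-1); last by ring.
  rewrite eV; nra.
rewrite !big_split /= -big_distrr /= -/(sqsum n s); lra.
Qed.

Lemma tratio_sqr n s m x : tratio n s m x ^+ 2 = x ^+ 2 / resid n s m x.
Proof. by rewrite /tratio expr_div_n sqr_sqrtr ?resid_ge0. Qed.

Lemma tratio_sqr_bounds n s m x e : 0 < e <= 1/6 -> 0 < sqsum n s ->
  cv2 n m * x ^+ 2 <= e ^+ 2 * sqsum n s ->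
  tratio n s m x ^+ 2 * (1 - 2 * e) <= x ^+ 2 / sqsum n s <=
  tratio n s m x ^+ 2 * (1 + 3 * e).
Proof.
move=> /andP[e0 e6] U0 h.
have e3 : 0 < e <= 1/3 by rewrite e0 /=; lra.
have /andP[h1 h2] := resid_bounds n s m x e e3 h.
have V0 : 0 < resid n s m x by apply: lt_le_trans h1; rewrite mulr_gt0//; lra.
rewrite tratio_sqr; move: (resid n s m x) (sqsum n s) (x ^+ 2) (sqr_ge0 x) V0 U0 h1 h2.
move=> V U t t0 V0 U0 h1 h2; apply/andP; split.
  rewrite ler_pdivlMr// -[leLHS]mulrA [leLHS]mulrAC ler_pdivrMr//.
  exact: ler_wpM2l.
rewrite ler_pdivrMr// -[leRHS]mulrA [leRHS]mulrAC ler_pdivlMr//.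
exact: ler_wpM2l.
Qed.

(** Cruder than [resid_bounds] but without smallness of [x]: it fits the statistic on the data,
    whose numerator is not a priori controlled by [sqsum]. *)
Lemma sqsum_le_resid n s m x : sqsum n s <= 2 * resid n s m x + 2 * (cv2 n m * x ^+ 2).
Proof.
rewrite -sqsum_shift /sqsum /resid !big_distrr /= -big_split /=.
apply: ler_sum => i _; set y := m i * _.
by have := sqr_ge0 (s i - 2 * y); nra.
Qed.

(** Holds also when [sqsum n s = 0]: all [s i] vanish then, so the value of a division by zero is
    harmless. *)
Lemma kurt_eq n s : kurt n s * sqsum n s ^+ 2 = quartsum n s.
Proof.
have [U0|/eqP U0] := eqVneq (sqsum n s) 0; last first.
  by rewrite /kurt divfK// expf_eq0 /=; apply/eqP.
rewrite U0 expr0n /= mulr0 /quartsum big1// => i _.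
have /eqP := U0; rewrite psumr_eq0; last by move=> *; exact: sqr_ge0.
move/allP/(_ i (mem_index_enum _)) => /=.
by rewrite sqrf_eq0 => /eqP ->; rewrite expr0n.
Qed.

Lemma kurt_ge0 n s : 0 <= kurt n s.
Proof. by rewrite divr_ge0 ?quartsum_ge0// exprn_ge0// sqsum_ge0. Qed.

Lemma sqr_le (x y : R) : 0 <= x -> x <= y -> x ^+ 2 <= y ^+ 2.
Proof. by move=> x0 xy; nra. Qed.

(* As the odd numbers sum to squares, [c j := (j h < y)] approximates [y ^ 2]. *)
Definition steps J (h : R) (c : nat -> bool) : R :=
  \sum_(j < J) (2 * j%:R + 1) * h ^+ 2 * (c j)%:R.

Lemma stepsS J h c :
  steps J.+1 h c = steps J h c + (2 * J%:R + 1) * h ^+ 2 * (c J)%:R.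
Proof. by rewrite /steps big_ord_recr. Qed.

Lemma steps_ge0 J h c : 0 <= steps J h c.
Proof.
apply: sumr_ge0 => j _; rewrite mulr_ge0//; apply: mulr_ge0; last exact: sqr_ge0.
by rewrite addr_ge0// mulr_ge0.
Qed.

Lemma steps_le_max J h c : steps J h c <= (J%:R * h) ^+ 2.
Proof.
elim: J => [|J IH]; first by rewrite /steps big_ord0 mul0r expr0n.
rewrite stepsS -natr1.
have : (2 * J%:R + 1) * h ^+ 2 * (c J)%:R <= (2 * J%:R + 1) * h ^+ 2.
  rewrite ler_piMr//; last by case: (c J).
  by rewrite mulr_ge0 ?sqr_ge0// addr_ge0// mulr_ge0.
nra.
Qed.

Lemma steps_le J (h y : R) (c : nat -> bool) : 0 <= h -> 0 <= y ->
  (forall j : nat, c j -> j%:R * h <= y) -> steps J h c <= (y + h) ^+ 2.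
Proof.
move=> h0 y0 cy; elim: J => [|J IH]; first by rewrite /steps big_ord0 sqr_ge0.
rewrite stepsS; case: (boolP (c J)) => [/cy Jy|_]; last by rewrite mulr0 addr0.
apply: le_trans (_ : (J.+1%:R * h) ^+ 2 <= _).
  by rewrite -natr1 mulr1; have := steps_le_max J h c; nra.
rewrite lerXn2r ?nnegrE ?mulr_ge0 ?addr_ge0//.
by rewrite -natr1 mulrDl mul1r lerD2r.
Qed.

Section StepsLower.
Variables (h y : R) (c : nat -> bool).
Hypotheses (h0 : 0 < h) (yc : forall j : nat, j%:R * h < y -> c j).

Lemma steps_max J : J%:R * h <= y -> steps J h c = (J%:R * h) ^+ 2.
Proof.
elim: J => [|J IH] Jy; first by rewrite /steps big_ord0 mul0r expr0n.
have Jy' : J%:R * h < y.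
  by apply: lt_le_trans Jy; rewrite -natr1 mulrDl mul1r ltrDl.
by rewrite stepsS (yc _ Jy') IH ?ltW// -natr1 /=; ring.
Qed.

Lemma steps_ge J : 0 <= y <= J%:R * h -> y ^+ 2 <= steps J h c.
Proof.
move=> /andP[y0]; elim: J => [|J IH] yJ.
  by rewrite mul0r in yJ; rewrite (_ : y = 0) ?expr0n ?steps_ge0//; apply/le_anti/andP.
case: (ltP (J%:R * h) y) => [Jy|/IH hJ]; last first.
  rewrite stepsS; apply: (le_trans hJ); rewrite lerDl mulr_ge0//.
  by rewrite mulr_ge0 ?sqr_ge0// addr_ge0// mulr_ge0.
rewrite stepsS (yc _ Jy) (steps_max _ (ltW Jy)) mulr1.
apply: le_trans (_ : (J.+1%:R * h) ^+ 2 <= _); last first.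
  by rewrite -natr1 le_eqVlt; apply/orP; left; apply/eqP; ring.
by rewrite lerXn2r ?nnegrE ?mulr_ge0// ltW.
Qed.

End StepsLower.

(** * Averages over sign vectors and recovery of [kurt] from distribution functions *)

Lemma sign_mean_le n (f g : {ffun 'I_n -> bool} -> R) :
  (forall b, f b <= g b) -> sign_mean n f <= sign_mean n g.
Proof.
move=> fg; rewrite /sign_mean ler_pM2r ?invr_gt0 ?exprn_gt0//.
by apply: ler_sum => b _.
Qed.

Lemma sign_meanE n (F : R) (f : {ffun 'I_n -> bool} -> R) :
  \sum_b f b = 2 ^+ n * F -> sign_mean n f = F.
Proof. by move=> h; rewrite /sign_mean h mulrC mulKf// expf_neq0. Qed.

Lemma sign_mean_cst n (c : R) : sign_mean n (fun=> c) = c.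
Proof. by apply: sign_meanE; rewrite sum_sign_const. Qed.

Lemma sign_meanD n (f g : {ffun 'I_n -> bool} -> R) :
  sign_mean n (fun b => f b + g b) = sign_mean n f + sign_mean n g.
Proof. by rewrite /sign_mean big_split mulrDl. Qed.

Lemma sign_meanZ n (c : R) (f : {ffun 'I_n -> bool} -> R) :
  sign_mean n (fun b => c * f b) = c * sign_mean n f.
Proof. by rewrite /sign_mean -big_distrr mulrA. Qed.

Lemma sign_mean_sum n J (f : 'I_J -> {ffun 'I_n -> bool} -> R) :
  sign_mean n (fun b => \sum_j f j b) = \sum_j sign_mean n (f j).
Proof. by rewrite /sign_mean exchange_big -big_distrl. Qed.

Definition zscore n s b := sign_sum n s b ^+ 2 / sqsum n s.

Section Moments.
Variables (n : nat) (s : nat -> R).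
Hypothesis U0 : 0 < sqsum n s.

Lemma mean_zscore : sign_mean n (zscore n s) = 1.
Proof.
apply: sign_meanE; rewrite -big_distrl /= sum_sign_sqr -/(sqsum n s).
by rewrite mulr1 mulfK// gt_eqF.
Qed.

Lemma mean_zscore2 : sign_mean n (fun b => zscore n s b ^+ 2) = 3 - 2 * kurt n s.
Proof.
apply: sign_meanE; rewrite (eq_bigr (fun b => sign_sum n s b ^+ 4 / sqsum n s ^+ 2)).
  rewrite -big_distrl /= sum_sign_pow4 -/(sqsum n s) -/(quartsum n s) /kurt.
  by field; rewrite gt_eqF.
by move=> b _; rewrite /zscore expr_div_n -exprM.
Qed.

Lemma mean_zscore3 : sign_mean n (fun b => zscore n s b ^+ 3) <= 15.
Proof.
rewrite /sign_mean ler_pdivrMr ?exprn_gt0// mulrC.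
rewrite (eq_bigr (fun b => sign_sum n s b ^+ 6 / sqsum n s ^+ 3)).
  rewrite -big_distrl /= ler_pdivrMr ?exprn_gt0//.
  by rewrite -mulrA; exact: sum_sign_pow6.
by move=> b _; rewrite /zscore expr_div_n -exprM.
Qed.

Lemma zscore_ge0 b : 0 <= zscore n s b.
Proof. by rewrite divr_ge0 ?sqr_ge0// ltW. Qed.

End Moments.

Definition sign_cdf n s m (t : R) : R :=
  #|[set b : {ffun 'I_n -> bool} | tratio n s m (sign_sum n s b) <= t]|%:R / 2 ^+ n.

Lemma sign_cdfE n s m t :
  sign_cdf n s m t = sign_mean n (fun b => (tratio n s m (sign_sum n s b) <= t)%R%:R).
Proof.
rewrite /sign_cdf /sign_mean; congr (_ / _).
rewrite -sum1_card natr_sum big_mkcond /=; apply: eq_bigr => b _.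
by case: ifPn => [|/negP]; rewrite inE /=; [move=> ->|move=> /negP/negbTE ->].
Qed.

(* Half-open, so that its mean is a combination of values of the cdf. *)
Definition outside (T y : R) : bool := (Num.sqrt y < T) || (T <= - Num.sqrt y).

Lemma outsideP T y : 0 <= y -> y < T ^+ 2 -> outside T y.
Proof.
move=> y0 yT; rewrite /outside.
have : Num.sqrt y < `|T| by rewrite -sqrtr_sqr ltr_sqrt// (le_lt_trans y0).
by rewrite ltr_normr => /orP[->//|h]; rewrite orbC lerNr ltW.
Qed.

Lemma outside_le T y : 0 <= y -> outside T y -> y <= T ^+ 2.
Proof.
move=> y0 h; have : Num.sqrt y <= `|T|.
  by rewrite ler_normr; case/orP: h => [/ltW->//|]; rewrite lerNr => ->; rewrite orbT.
by rewrite -sqrtr_sqr ler_sqrt// sqr_ge0.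
Qed.

Lemma mean_outside n s m y :
  sign_mean n (fun b => (outside (tratio n s m (sign_sum n s b)) y)%:R) =
  1 - sign_cdf n s m (Num.sqrt y) + sign_cdf n s m (- Num.sqrt y).
Proof.
rewrite !sign_cdfE -mulN1r -sign_meanZ -[X in X + _ + _](sign_mean_cst n 1) -!sign_meanD.
congr (_ / _); apply: eq_bigr => b _; rewrite /outside.
set T := tratio _ _ _ _; set r := Num.sqrt y.
have r0 : 0 <= r by exact: sqrtr_ge0.
by case: (leP T r) => h1; case: (leP T (- r)) => h2 /=;
  rewrite ?mulr1n ?mulr0n; lra.
Qed.

(* The level [L = 1/delta] truncates [z^2]; beyond it the sixth moment takes over. *)
Lemma mean_steps n s m (delta : R) (J : nat) : 0 < delta <= 1/6 ->
  2 / delta <= J%:R * delta <= 3 / delta -> 0 < sqsum n s ->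
  0 <= cv2 n m <= delta ^+ 3 ->
  `| sign_mean n (fun b => steps J delta
        (fun j => outside (tratio n s m (sign_sum n s b)) (j%:R * delta)))
     - (3 - 2 * kurt n s) | <= 210 * delta.
Proof.
move=> /andP[d0 d6] /andP[J2 J3] U0 /andP[r0 rd].
rewrite -mean_zscore2// -mulN1r -sign_meanZ -sign_meanD.
set f := fun b => _ + _.
have dV0 : 0 < delta^-1 by rewrite invr_gt0.
have dV : delta * delta^-1 = 1 by rewrite mulfV// gt_eqF.
(* The means of [z^2] and [z^3] are at most 3 and 15, whence 23 * 3 + 6 + 9 * 15 = 210. *)
suff key b : `|f b| <= delta * (23 * zscore n s b ^+ 2 + 6) + 9 * delta * zscore n s b ^+ 3.
  have hle : sign_mean n (fun b => delta * (23 * zscore n s b ^+ 2 + 6)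
      + 9 * delta * zscore n s b ^+ 3) <= 210 * delta.
    rewrite sign_meanD !sign_meanZ sign_meanD sign_meanZ sign_mean_cst mean_zscore2//.
    have := mean_zscore3 n s U0; have := kurt_ge0 n s => k0 h3.
    have := mulr_ge0 k0 (ltW d0) => h1.
    have := ler_wpM2l (ltW d0) h3 => h2; nra.
  rewrite ler_norml; apply/andP; split.
    rewrite lerNl; apply: le_trans hle; rewrite -mulN1r -sign_meanZ.
    apply: sign_mean_le => b; rewrite mulN1r; apply: le_trans (key b).
    by rewrite -normrN ler_norm.
  apply: le_trans hle; apply: sign_mean_le => b; apply: le_trans (key b).
  exact: ler_norm.
rewrite /f {f}; set T := tratio _ _ _ _; set z := zscore n s b.
set c := fun j : nat => _; set phi := steps _ _ _.
have z0 : 0 <= z by exact: zscore_ge0.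
have z20 := sqr_ge0 z.
have phi0 : 0 <= phi by exact: steps_ge0.
have phiM : phi <= (J%:R * delta) ^+ 2 by exact: steps_le_max.
rewrite mulN1r; have [zL|zL] := leP z delta^-1.
  (* Below the level, [cv2 x^2 = cv2 z U <= delta^3 (1/delta) U]: the smallness that
     [tratio_sqr_bounds] asks for with [e = delta]. *)
  have hx : cv2 n m * sign_sum n s b ^+ 2 <= delta ^+ 2 * sqsum n s.
    rewrite -ler_pdivrMr// -mulrA -/(zscore n s b) -/z.
    apply: le_trans (_ : delta ^+ 3 * delta^-1 <= _).
      by apply: ler_pM.
    by rewrite exprS mulrAC dV mul1r.
  have d6' : 0 < delta <= 1/6 by rewrite d0.
  have /andP[] := tratio_sqr_bounds _ _ _ _ _ d6' U0 hx.
  rewrite -/T -/(zscore n s b) -/z => t1 t2.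
  have T0 := sqr_ge0 T.
  have h1 : phi <= (T ^+ 2 + delta) ^+ 2.
    apply: steps_le => //; first exact: ltW.
    by move=> j; apply: outside_le; rewrite mulr_ge0// ltW.
  have h2 : (T ^+ 2) ^+ 2 <= phi.
    apply: steps_ge => //.
      by move=> j; apply: outsideP; rewrite mulr_ge0// ltW.
    rewrite T0 /=; apply: le_trans J2.
    have : T ^+ 2 <= 2 * z by nra.
    by rewrite [2 / _]mulrC; lra.
  move: (T ^+ 2) T0 h1 h2 t1 t2 => t T0 h1 h2 t1 t2.
  have ht : t <= (1 + 6 * delta) * z by nra.
  have hz3 : 0 <= z ^+ 3 by exact: exprn_ge0.
  have hz4 : 0 <= 9 * delta * z ^+ 3 by rewrite mulr_ge0// mulr_ge0// ltW.
  rewrite ler_norml; apply/andP; split.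
    have a1 : z ^+ 2 <= t ^+ 2 * (1 + 3 * delta) ^+ 2.
      by rewrite -exprMn; exact: sqr_le.
    have a2 : t ^+ 2 <= (1 + 6 * delta) ^+ 2 * z ^+ 2.
      by rewrite -exprMn; exact: sqr_le.
    have a3 : t ^+ 2 <= 4 * z ^+ 2 by nra.
    have t20 := sqr_ge0 t.
    have a4 : t ^+ 2 * (1 + 3 * delta) ^+ 2 <= t ^+ 2 * (1 + 15 / 2 * delta) by nra.
    have a5 : 0 <= delta * (4 * z ^+ 2 - t ^+ 2).
      by apply: mulr_ge0; [exact: ltW|rewrite subr_ge0].
    nra.
  have b1 : (t + delta) ^+ 2 <= ((1 + 6 * delta) * z + delta) ^+ 2.
    by apply: sqr_le; [lra|rewrite lerD2r].
  have b2 : ((1 + 6 * delta) * z + delta) ^+ 2 - z ^+ 2 =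
     delta * ((6 * z + 1) * (2 * z + delta * (6 * z + 1))) by ring.
  have b3 : (6 * z + 1) * (2 * z + delta * (6 * z + 1)) <= 23 * z ^+ 2 + 6.
    have : delta * (6 * z + 1) <= 1/6 * (6 * z + 1) by rewrite ler_wpM2r//; lra.
    have : 0 <= (z - 1) ^+ 2 by exact: sqr_ge0.
    nra.
  have b4 : delta * ((6 * z + 1) * (2 * z + delta * (6 * z + 1))) <=
     delta * (23 * z ^+ 2 + 6) by rewrite ler_wpM2l// ltW.
  lra.
(* Beyond the level the statistic is not compared with [z]: both terms are at most [9 z^2], and
   [z^2 <= delta z^3] since [delta z > 1]. *)
have c1 : (J%:R * delta) ^+ 2 <= 9 * z ^+ 2.
  have J30 : 0 <= J%:R * delta by rewrite mulr_ge0// ltW.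
  have : J%:R * delta <= 3 * z by apply: (le_trans J3); rewrite ler_wpM2l// ltW.
  nra.
have c2 : z ^+ 2 <= delta * z ^+ 3.
  have : 1 <= delta * z by rewrite -ler_pdivrMl// mulr1 ltW.
  by move=> h; rewrite (_ : delta * z ^+ 3 = (delta * z) * z ^+ 2); [rewrite ler_peMl|ring].
have c3 : 0 <= delta * (23 * z ^+ 2 + 6) by apply: mulr_ge0; [exact: ltW|lra].
rewrite ler_norml; apply/andP; split; lra.
Qed.

(* Uniform closeness of the two laws carries over to their fourth moments, which
   determine [kurt]. *)
Lemma kurt_close (tau : R) : 0 < tau ->
  exists eps r : R, [/\ 0 < eps, 0 < r &
    forall n s m n' s' m', 0 < sqsum n s -> 0 < sqsum n' s' ->
      0 <= cv2 n m <= r -> 0 <= cv2 n' m' <= r ->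
      (forall t, `| sign_cdf n s m t - sign_cdf n' s' m' t | <= eps) ->
      `| kurt n s - kurt n' s' | <= tau].
Proof.
(* Each use of [mean_steps] then costs at most [tau / 2]; with [tau / 2] more for the distance of
   the distribution functions, [2 |kurt - kurt'| <= 3 tau / 2]. *)
move=> tau0; pose delta := Num.min (1/6) (tau / 420).
have d0 : 0 < delta by rewrite lt_min; apply/andP; split; lra.
have d6 : delta <= 1/6 by rewrite ge_min lexx.
have dt : delta <= tau / 420 by rewrite ge_min lexx orbT.
have dd : 0 < delta <= 1/6 by rewrite d0.
have dV0 : 0 < delta^-1 by rewrite invr_gt0.
have dV : delta * delta^-1 = 1 by rewrite mulfV// gt_eqF.
pose J := (Num.truncn (2 / delta ^+ 2)).+1.
have q0 : 0 <= 2 / delta ^+ 2 by rewrite divr_ge0// exprn_ge0// ltW.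
have /andP[J1 J2] := truncn_itv q0.
have hJ : 2 / delta <= J%:R * delta <= 3 / delta.
  have e2 : 2 / delta ^+ 2 * delta = 2 / delta.
    by field; rewrite gt_eqF.
  apply/andP; split; first by rewrite -e2 ler_wpM2r// ltW.
  rewrite /J -natr1 mulrDl mul1r; apply: le_trans (_ : 2 / delta + delta <= _).
    by rewrite lerD2r -e2 ler_wpM2r// ltW.
  rewrite (_ : 3 / delta = 2 / delta + delta^-1); last by ring.
  rewrite lerD2l; apply: (@le_trans _ _ 1); first lra.
  by rewrite invf_ge1//; lra.
(* [K] bounds the total weight in [steps]. Each weight multiplies two values of a distribution
   function, so the tolerance [tau / (4 K)] yields an error of at most [tau / 2]. *)
pose K := (J%:R * delta) ^+ 2 + 1.
have K0 : 0 < K by rewrite ltr_wpDl// sqr_ge0.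
exists (tau / (4 * K)), (delta ^+ 3); split.
- by rewrite divr_gt0// mulr_gt0.
- by rewrite exprn_gt0.
move=> n s m n' s' m' U0 U0' r r' hcl.
have h1 := mean_steps n s m delta J dd hJ U0 r.
have h2 := mean_steps n' s' m' delta J dd hJ U0' r'.
move: h1 h2; rewrite /steps !sign_mean_sum.
rewrite (eq_bigr (fun j : 'I_J => (2 * j%:R + 1) * delta ^+ 2 *
  (1 - sign_cdf n s m (Num.sqrt (j%:R * delta))
     + sign_cdf n s m (- Num.sqrt (j%:R * delta))))); last first.
  by move=> j _; rewrite sign_meanZ mean_outside.
set a := \sum_(j < J) _.
rewrite (eq_bigr (fun j : 'I_J => (2 * j%:R + 1) * delta ^+ 2 *
  (1 - sign_cdf n' s' m' (Num.sqrt (j%:R * delta))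
     + sign_cdf n' s' m' (- Num.sqrt (j%:R * delta))))); last first.
  by move=> j _; rewrite sign_meanZ mean_outside.
set a' := \sum_(j < J) _ => h1 h2.
have haa : `|a - a'| <= tau / 2.
  rewrite /a /a' -sumrB; apply: (le_trans (ler_norm_sum _ _ _)).
  apply: le_trans (_ : \sum_(j < J) (2 * j%:R + 1) * delta ^+ 2 * (tau / (2 * K)) <= _).
    apply: ler_sum => j _; rewrite -mulrBr normrM ger0_norm; last first.
      by rewrite mulr_ge0 ?sqr_ge0// addr_ge0// mulr_ge0.
    rewrite ler_wpM2l//.
      by rewrite mulr_ge0 ?sqr_ge0// addr_ge0// mulr_ge0.
    have := hcl (Num.sqrt (j%:R * delta)); have := hcl (- Num.sqrt (j%:R * delta)).
    have -> : tau / (2 * K) = tau / (4 * K) + tau / (4 * K) by field; rewrite gt_eqF.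
    rewrite !ler_norml => /andP[? ?] /andP[? ?]; apply/andP; split; lra.
  rewrite -big_distrl /=.
  have := steps_le_max J delta (fun=> true).
  rewrite /steps (eq_bigr (fun j : 'I_J => (2 * j%:R + 1) * delta ^+ 2)); last first.
    by move=> j _; rewrite /= mulr1.
  set S := \sum_(_ < _) _ => hs.
  have -> : tau / (2 * K) = (tau / 2) / K by field; rewrite gt_eqF.
  rewrite mulrA ler_pdivrMr// mulrC ler_wpM2l//; first lra.
  by rewrite /K; lra.
move: h1 h2 haa; rewrite !ler_norml => /andP[? ?] /andP[? ?] /andP[? ?].
apply/andP; split; lra.
Qed.

Lemma sign_mean_opp n s (f : R -> R) :
  sign_mean n (fun b => f (sign_sum n s b)) = sign_mean n (fun b => f (- sign_sum n s b)).
Proof.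
rewrite /sign_mean; congr (_ / _).
pose fl (b : {ffun 'I_n -> bool}) : {ffun 'I_n -> bool} := [ffun i => ~~ b i].
have flK : involutive fl by move=> b; apply/ffunP => i; rewrite !ffunE negbK.
rewrite (reindex_inj (inv_inj flK)) /=; apply: eq_bigr => b _; congr (f _).
rewrite /sign_sum -sumrN; apply: eq_bigr => i _; rewrite ffunE.
by case: (b i); rewrite /rad /=; ring.
Qed.

(* Paley--Zygmund, in the form [1_{1/4 <= z <= 9} >= (z - 1/4)(9 - z)/20]. *)
Lemma sign_cdf_tails n s m : 0 < sqsum n s -> 0 <= cv2 n m <= 1/324 ->
  1/10 <= sign_cdf n s m (- (1/3)) /\ sign_cdf n s m (1/3) <= 9/10.
Proof.
move=> U0 /andP[r0 r1].
pose g (x : R) : R := ((0 < x) && (1/4 <= x ^+ 2 / sqsum n s <= 9))%:R.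
(* As [z] has mean 1 and [z^2] mean at most 3, the polynomial has mean at least 37/80 - 3/20 - 9/80
   = 1/5; by symmetry the two signs share the event equally. *)
have gmean : 1/10 <= sign_mean n (fun b => g (sign_sum n s b)).
  have h : sign_mean n (fun b => 37/80 * zscore n s b + (-1/20) * zscore n s b ^+ 2 + (-9/80)) <=
     sign_mean n (fun b => g (sign_sum n s b) + g (- sign_sum n s b)).
    apply: sign_mean_le => b; rewrite /g sqrrN -/(zscore n s b) oppr_gt0.
    have := zscore_ge0 n s U0 b.
    have : sign_sum n s b = 0 -> zscore n s b = 0.
      by move=> x0; rewrite /zscore x0 expr0n mul0r.
    move: (zscore n s b) => z; have := sqr_ge0 (z - 37/8); case: (ltgtP 0 (sign_sum n s b)) => hx zs zx z0 /=.
    + by case: (leP (1/4) z) => h1; case: (leP z 9) => h2 /=; rewrite ?mulr1n ?mulr0n; nra.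
    + by case: (leP (1/4) z) => h1; case: (leP z 9) => h2 /=; rewrite ?mulr1n ?mulr0n; nra.
    + by rewrite zx //; lra.
  move: h; rewrite sign_meanD -(sign_mean_opp n s g) !sign_meanD !sign_meanZ sign_mean_cst.
  by rewrite mean_zscore// mean_zscore2//; have := kurt_ge0 n s; lra.
have gT x : g x != 0 -> 1/3 < tratio n s m x.
  rewrite /g; case: (boolP (0 < x)) => [x0|]; last by rewrite /= eqxx.
  case: (boolP (_ <= _ <= _)) => [/andP[z1 z9]|]; last by rewrite /= eqxx.
  (* 1/324 is (1/6)^2 / 9, so [z <= 9] permits [e = 1/6]; then
     [T^2 >= (1/4) / (3/2) = 1/6 > 1/9]. *)
  move=> _; have e6 : 0 < (1/6 : R) <= 1/6 by apply/andP; split; lra.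
  have hx : cv2 n m * x ^+ 2 <= (1/6) ^+ 2 * sqsum n s.
    rewrite -ler_pdivrMr// -mulrA; apply: le_trans (_ : 1/324 * 9 <= _); last by lra.
    by apply: ler_pM => //; rewrite divr_ge0 ?sqr_ge0// ltW.
  have /andP[_ h] := tratio_sqr_bounds _ _ _ _ _ e6 U0 hx.
  have T0 : 0 <= tratio n s m x by rewrite divr_ge0 ?sqrtr_ge0// ltW.
  rewrite ltNge; apply/negP => h3; have := sqr_le _ _ T0 h3; lra.
have gT' x : g (- x) != 0 -> tratio n s m x <= - (1/3).
  rewrite /g sqrrN oppr_gt0; case: (boolP (x < 0)) => [x0|]; last by rewrite /= eqxx.
  case: (boolP (_ <= _ <= _)) => [/andP[z1 z9]|]; last by rewrite /= eqxx.
  move=> _; have e6 : 0 < (1/6 : R) <= 1/6 by apply/andP; split; lra.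
  have hx : cv2 n m * x ^+ 2 <= (1/6) ^+ 2 * sqsum n s.
    rewrite -ler_pdivrMr// -mulrA; apply: le_trans (_ : 1/324 * 9 <= _); last by lra.
    by apply: ler_pM => //; rewrite divr_ge0 ?sqr_ge0// ltW.
  have /andP[_ h] := tratio_sqr_bounds _ _ _ _ _ e6 U0 hx.
  have T0 : tratio n s m x <= 0 by rewrite mulr_le0_ge0 ?invr_ge0 ?sqrtr_ge0// ltW.
  rewrite leNgt; apply/negP => h3; nra.
split.
  apply: (le_trans gmean); rewrite sign_mean_opp sign_cdfE; apply: sign_mean_le => b.
  have := gT' (sign_sum n s b); case: (g _ =P 0) => [-> _|_ h].
    by rewrite ler0n.
  by rewrite h// /g; case: (_ && _).
have : sign_mean n (fun b => g (sign_sum n s b)) <= 1 - sign_cdf n s m (1/3).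
  rewrite sign_cdfE -mulN1r -sign_meanZ -[X in X + _](sign_mean_cst n 1) -sign_meanD.
  apply: sign_mean_le => b; have := gT (sign_sum n s b).
  case: (g _ =P 0) => [-> _|_ h]; first by case: (tratio _ _ _ _ <= _) => /=; lra.
  have := h isT; rewrite ltNge => /negbTE ->.
  by rewrite /g; case: (_ && _) => /=; lra.
lra.
Qed.

End SignSums.

(** * Independent and identically distributed sequences *)

Section Rectangles.
Context {d : measure_display} {T : measurableType d}.

Definition rect n (B : nat -> set T) : set (n.-tuple T) :=
  [set t | forall i : 'I_n, B i (tnth t i)].

Definition rects n : set (set (n.-tuple T)) :=
  [set A | exists2 B, (forall i : nat, measurable (B i)) & A = rect n B].

Lemma measurable_rect n B : (forall i, measurable (B i)) -> measurable (rect n B).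
Proof.
move=> mB; have -> : rect n B = \bigcap_(i in [set: 'I_n]) ((@tnth n T)^~ i @^-1` B i).
  by apply/seteqP; split=> t /= h i; [move=> _; exact: h|exact: h].
apply: fin_bigcap_measurable; first exact: finite_finset.
move=> i _; rewrite -[X in measurable X]setTI.
by apply: measurable_tnth.
Qed.

Lemma rects_setI n : setI_closed (rects n).
Proof.
move=> _ _ [B mB ->] [C mC ->]; exists (fun i => B i `&` C i).
  by move=> i; exact: measurableI.
apply/seteqP; split=> t /=; first by move=> [h1 h2] i.
by move=> h; split=> i; case: (h i).
Qed.

Lemma measurable_rects n : @measurable _ (n.-tuple T) = <<s rects n >>.
Proof.
apply/seteqP; split; last first.
  apply: smallest_sub; first exact: sigma_algebra_measurable.
  by move=> _ [B mB ->]; exact: measurable_rect.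
apply: smallest_sub; first exact: smallest_sigma_algebra.
move=> A; rewrite -bigcup_seq => -[i _ [B mB <-]].
apply: sub_sigma_algebra; exists (fun j => if j == i :> nat then B else setT).
  by move=> j; case: ifP.
rewrite setTI; apply/seteqP; split=> t /=.
  by move=> h j; case: eqP => // /val_inj ->.
by move=> /(_ i); rewrite eqxx.
Qed.

(** Rectangles form a pi-system that generates the sigma-algebra and contains the whole space. *)
Lemma tuple_measure_unique (R : realType) n (m1 m2 : {measure set (n.-tuple T) -> \bar R}) :
  (m1 setT < +oo)%E ->
  (forall B, (forall i, measurable (B i)) -> m1 (rect n B) = m2 (rect n B)) ->
  forall A, measurable A -> m1 A = m2 A.
Proof.
move=> fin h; apply: (measure_unique (rects n) (fun=> setT)) => //.
- exact: measurable_rects.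
- exact: rects_setI.
- by move=> _; exists (fun=> setT) => //; apply/seteqP; split=> t.
- by apply/seteqP; split=> // t _; exists 0%N.
- by move=> _ [B mB ->]; exact: h.
Qed.

End Rectangles.

Definition iid {d : measure_display} {Omega : measurableType d} {R : realType}
  (P : probability Omega R) (S : nat -> Omega -> R) : Prop :=
  [/\ forall g, measurable_fun setT (S g),
   forall (J : seq nat) (B : nat -> set R), uniq J ->
     (forall j, measurable (B j)) ->
     P (\bigcap_(j in [set` J]) (S j @^-1` B j)) =
       (\prod_(j <- J) P (S j @^-1` B j))%E &
   forall g (B : set R), measurable B -> P (S g @^-1` B) = P (S 0%N @^-1` B)].

Section Iid.
Context {d : measure_display} {Omega : measurableType d} {R : realType}.
Variables (P : probability Omega R) (S : nat -> Omega -> R).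
Hypothesis iidS : iid P S.

Let mS g : measurable_fun setT (S g). Proof. by case: iidS. Qed.

Definition vec n (f : nat -> nat) (w : Omega) : n.-tuple R := [tuple S (f i) w | i < n].

Lemma measurable_vec n f : measurable_fun setT (vec n f).
Proof.
apply/measurable_fun_tnthP => i.
rewrite (_ : _ \o _ = S (f i)); first exact: mS.
by apply/funext => w /=; rewrite tnth_mktuple.
Qed.

Lemma measurable_vec_preimage n f A : measurable A -> measurable (vec n f @^-1` A).
Proof. by move=> mA; rewrite -[X in measurable X]setTI; exact: measurable_vec. Qed.

Lemma vec_rect n f (B : nat -> set R) : vec n f @^-1` rect n B =
  \bigcap_(i in [set: 'I_n]) (S (f i) @^-1` B i).
Proof.
by apply/seteqP; split=> w /= h i => [_|]; have := h i; rewrite ?tnth_mktuple; exact.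
Qed.

Definition inj_below n (f : nat -> nat) :=
  forall i j : nat, (i < n)%N -> (j < n)%N -> f i = f j -> i = j.

Lemma uniq_map_inj_below n f : inj_below n f -> uniq [seq f i | i <- iota 0 n].
Proof.
move=> finj; rewrite map_inj_in_uniq ?iota_uniq// => i j.
by rewrite !mem_iota /= !add0n; exact: finj.
Qed.

Lemma prob_rect n f (B : nat -> set R) : inj_below n f ->
  (forall i, measurable (B i)) ->
  P (\bigcap_(i in [set: 'I_n]) (S (f i) @^-1` B i)) =
    (\prod_(i < n) P (S 0%N @^-1` B i))%E.
Proof.
move=> finj mB; case: iidS => _ prodP idP.
(* Independence indexes the sides by observations, not by positions; injectivity of [f] lets [index]
   carry the sides over. *)
pose C j := B (index j [seq f i | i <- iota 0 n]).
have Cf i : (i < n)%N -> C (f i) = B i.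
  move=> ni; rewrite /C.
  have -> : f i = nth 0%N [seq f i | i <- iota 0 n] i.
    by rewrite (nth_map 0%N) ?size_iota// nth_iota.
  by rewrite index_uniq ?size_map ?size_iota//; exact: uniq_map_inj_below.
have := prodP _ C (uniq_map_inj_below _ _ finj) (fun j => mB _).
have iotaE (F : nat -> \bar R) : (\prod_(i <- iota 0 n) F i = \prod_(i < n) F i)%E.
  by rewrite -(big_mkord xpredT) /index_iota subn0.
rewrite big_map iotaE => h.
transitivity (\prod_(i < n) P (S (f i) @^-1` C (f i)))%E; last first.
  by apply: eq_bigr => i _; rewrite idP ?Cf// /C.
rewrite -h; congr (P _); apply/seteqP; split=> w /=.
  move=> hw j; rewrite /= => /mapP[i]; rewrite mem_iota /= add0n => ni ->.
  by rewrite Cf//; exact: (hw (Ordinal ni)).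
move=> hw i _; rewrite -(Cf i)//; apply: hw => /=.
by apply/mapP; exists (i : nat); rewrite // mem_iota /= add0n.
Qed.

(** Exchangeability: a rectangle has the same probability along every selection of distinct
    observations, and rectangles determine the law. *)
Lemma vec_law n f f' A : inj_below n f -> inj_below n f' -> measurable A ->
  P (vec n f @^-1` A) = P (vec n f' @^-1` A).
Proof.
move=> finj finj' mA.
have := @tuple_measure_unique _ _ R n (pushforward P (vec n f)) (pushforward P (vec n f')).
move=> /(_ (measurable_vec n f) (measurable_vec n f') _ _ A mA).
apply.
  by have : (P setT < +oo)%E by rewrite probability_setT ltry.
move=> B mB; have : P (vec n f @^-1` rect n B) = P (vec n f' @^-1` rect n B).
  by rewrite !vec_rect !prob_rect.
by [].
Qed.

(** Uniqueness on rectangles is applied to the restriction of [P] to [D] and to [P] scaled by [P D],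
    both pushed forward along [vec]. *)
Lemma prob_indep_rect n f (D : set Omega) A : measurable D -> measurable A ->
  (forall B, (forall i, measurable (B i)) ->
    P (vec n f @^-1` rect n B `&` D) = (P (vec n f @^-1` rect n B) * P D)%E) ->
  P (vec n f @^-1` A `&` D) = (P (vec n f @^-1` A) * P D)%E.
Proof.
move=> mD mA h.
have pD : (0 <= fine (P D)) by rewrite fine_ge0.
have := @tuple_measure_unique _ _ R n (pushforward (mrestr P mD) (vec n f))
  (mscale (NngNum pD) (pushforward P (vec n f))).
move=> /(_ (measurable_vec n f) (measurable_vec n f) _ _ A mA).
have PDE : (fine (P D))%:E = P D by rewrite fineK// fin_num_measure.
move=> key; suff e : P (vec n f @^-1` A `&` D) = ((fine (P D))%:E * P (vec n f @^-1` A))%E.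
  by rewrite e PDE muleC.
apply: key.
  suff : (P (vec n f @^-1` setT `&` D) < +oo)%E by [].
  by rewrite preimage_setT setTI (le_lt_trans (probability_le1 P mD))// ltry.
move=> B mB.
suff : P (vec n f @^-1` rect n B `&` D) = ((fine (P D))%:E * P (vec n f @^-1` rect n B))%E.
  by [].
by rewrite h// PDE muleC.
Qed.

(* Two applications of the uniqueness of measures on rectangles, one per block. *)
Lemma vec_indep n k f f' A A' :
  inj_below n f -> inj_below k f' ->
  (forall i j : nat, (i < n)%N -> (j < k)%N -> f i <> f' j) ->
  measurable A -> measurable A' ->
  P (vec n f @^-1` A `&` vec k f' @^-1` A') =
  (P (vec n f @^-1` A) * P (vec k f' @^-1` A'))%E.
Proof.
move=> finj finj' ff' mA mA'.
apply: prob_indep_rect => //; first exact: measurable_vec_preimage.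
move=> B mB; rewrite setIC muleC.
apply: prob_indep_rect => //; first by apply: measurable_vec_preimage; exact: measurable_rect.
move=> B' mB'; rewrite setIC muleC.
pose g i := if (i < n)%N then f i else f' (i - n)%N.
pose C i := if (i < n)%N then B i else B' (i - n)%N.
have ginj : inj_below (n + k) g.
  move=> i j ni nj; rewrite /g; case: ltnP => hi; case: ltnP => hj.
  - exact: finj.
  - by move/ff' => h; exfalso; apply: h; lia.
  - by move/esym/ff' => h; exfalso; apply: h; lia.
  - move/finj' => h; have : (i - n = j - n)%N by apply: h; lia.
    by lia.
have mC i : measurable (C i) by rewrite /C; case: ifP.
rewrite !vec_rect (prob_rect _ _ _ finj)// (prob_rect _ _ _ finj')//.
transitivity (P (\bigcap_(i in [set: 'I_(n + k)]) (S (g i) @^-1` C i))).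
  congr (P _); apply/seteqP; split=> w /=.
    move=> [h1 h2] i _; rewrite /g /C; case: ltnP => hi.
      exact: (h1 (Ordinal hi) I).
    have hk : (i - n < k)%N by rewrite ltn_subLR.
    exact: (h2 (Ordinal hk) I).
  move=> hw; split=> i _.
    by have := hw (lshift k i) I; rewrite /g /C /= ltn_ord.
  have := hw (rshift n i) I; rewrite /g /C /=.
  by rewrite ltnNge leq_addr /= addKn.
rewrite prob_rect// big_split_ord /=; congr (_ * _)%E; apply: eq_bigr => i _.
  by rewrite /C ltn_ord.
by rewrite /C ltnNge leq_addr /= addKn.
Qed.

End Iid.

(** * Events depending on finitely many observations *)

Section RealProbability.
Context {d : measure_display} {Omega : measurableType d} {R : realType}.
Variable P : probability Omega R.
Implicit Types A B C : set Omega.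

Definition pr A : R := fine (P A).

Lemma prE A : measurable A -> P A = (pr A)%:E.
Proof. by move=> mA; rewrite fineK// fin_num_measure. Qed.

Lemma pr_ge0 A : 0 <= pr A. Proof. exact: fine_ge0. Qed.

Lemma pr_le1 A : measurable A -> pr A <= 1.
Proof. by move=> mA; rewrite -lee_fin -prE// probability_le1. Qed.

Lemma pr_le A B : measurable A -> measurable B -> A `<=` B -> pr A <= pr B.
Proof. by move=> mA mB AB; rewrite -lee_fin -!prE// le_measure// inE. Qed.

Lemma prC A : measurable A -> pr (~` A) = 1 - pr A.
Proof.
by move=> mA; apply: EFin_inj; rewrite -prE; [rewrite probability_setC// prE|exact: measurableC].
Qed.

Lemma prU A B : measurable A -> measurable B -> pr (A `|` B) <= pr A + pr B.
Proof.
move=> mA mB; rewrite -lee_fin EFinD -!prE//; last exact: measurableU.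
exact: measureU2.
Qed.

Lemma pr_bigU n (A : nat -> set Omega) : (forall i, measurable (A i)) ->
  pr (\big[setU/set0]_(i < n) A i) <= \sum_(i < n) pr (A i).
Proof.
move=> mA; elim: n => [|n IH]; first by rewrite !big_ord0 /pr measure0.
rewrite !big_ord_recr /=; apply: (le_trans (prU _ _ _ _)) => //.
  exact: bigsetU_measurable.
by rewrite lerD2r.
Qed.

Lemma pr_cover A B C a b : measurable A -> measurable B -> measurable C ->
  A `<=` B `|` C -> pr B <= a -> pr C <= b -> pr A <= a + b.
Proof.
move=> mA mB mC sub hB hC; apply: le_trans (lerD hB hC).
by apply: le_trans (prU _ _ mB mC); apply: pr_le => //; exact: measurableU.
Qed.

Lemma pr_neq0 A : 0 < pr A -> exists w, A w.
Proof.
move=> h; apply/set0P/eqP => A0; move: h.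
by rewrite A0 /pr measure0 /= ltxx.
Qed.

(** The left side is the expected number of events that occur, so a count bounded at each data point
    bounds the sum of probabilities. *)
Lemma sum_pr_le (I : finType) (E : I -> set Omega) (K : R) :
  (forall i, measurable (E i)) ->
  (forall w, \sum_i (\1_(E i) w : R) <= K) -> \sum_i pr (E i) <= K.
Proof.
move=> mE h.
rewrite -lee_fin -sumEFin (eq_bigr (fun i => \int[P]_w (\1_(E i) w : R)%:E)%E); last first.
  by move=> i _; rewrite -prE// integral_indic// setIT.
rewrite -ge0_integral_sum//.
- have -> : K%:E = (\int[P]_w (cst K%:E w))%E.
    rewrite integral_cst// [X in (_ * X)%E](_ : _ = 1%E) ?mule1//.
    exact: probability_setT.
  apply: ge0_le_integral => //.
  + by move=> w _; apply: sume_ge0 => i _; rewrite lee_fin.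
  + by apply: emeasurable_sum => i; apply/measurable_EFinP; exact: measurable_indic.
  + by move=> w _; rewrite sumEFin lee_fin.
- by move=> i; apply/measurable_EFinP; exact: measurable_indic.
Qed.

End RealProbability.

Section MeasurableSets.
Context {d : measure_display} {T : measurableType d} {R : realType}.
Implicit Types f g : T -> R.

Lemma measurable_le_set f g : measurable_fun setT f -> measurable_fun setT g ->
  measurable [set x | f x <= g x].
Proof. by move=> mf mg; rewrite -[X in measurable X]setTI; exact: measurable_fun_le. Qed.

Lemma measurable_lt_set f g : measurable_fun setT f -> measurable_fun setT g ->
  measurable [set x | f x < g x].
Proof.
move=> mf mg; rewrite (_ : [set x | _] = ~` [set x | g x <= f x]).
  exact/measurableC/measurable_le_set.
by apply/seteqP; split=> x /=; rewrite ltNge => /negP.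
Qed.

Lemma measurable_inv f : measurable_fun setT f -> measurable_fun setT (fun x => (f x)^-1).
Proof.
move=> mf; apply: (@measurableT_comp _ _ _ _ _ _ (@GRing.inv R)) => //.
rewrite -(setvU [set 0 : R]); apply/measurable_funU => //; first exact: measurableC.
split; last first.
  exact: measurable_fun_set1.
apply: open_continuous_measurable_fun.
  by apply: closed_openC; exact: closed_eq.
by move=> x; rewrite inE /= => /eqP x0; exact: inv_continuous.
Qed.

Lemma measurable_sqrt f : measurable_fun setT f ->
  measurable_fun setT (fun x => Num.sqrt (f x)).
Proof.
move=> mf; apply: (@measurableT_comp _ _ _ _ _ _ (@Num.sqrt R)) => //.
by apply: continuous_measurable_fun; exact: sqrt_continuous.
Qed.

End MeasurableSets.

Section LocalEvents.
Context {R : realType}.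
Implicit Types (F H : (nat -> R) -> R) (E : set (nat -> R)).

Definition agree_below n (x y : nat -> R) := forall i, (i < n)%N -> x i = y i.

(** Statistics are functions of a whole sequence so that one formula can be read along any selection
    of observations. Locality ties them to [n]-tuples, where uniqueness of measures applies, and
    makes the default 0 of [nth] irrelevant. *)
Definition mloc n F :=
  measurable_fun [set: n.-tuple R] (fun t : n.-tuple R => F (nth 0 t)) /\
  forall x y, agree_below n x y -> F x = F y.

Definition mev n E :=
  measurable [set t : n.-tuple R | E (nth 0 t)] /\
  forall x y, agree_below n x y -> E x -> E y.

Lemma mloc_coord n i : (i < n)%N -> mloc n (fun x => x i).
Proof.
move=> ni; split; last by move=> x y; exact.
rewrite (_ : (fun t => _) = (fun t : n.-tuple R => tnth t (Ordinal ni))).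
  exact: measurable_tnth.
by apply/funext => t; rewrite (tnth_nth 0).
Qed.

Lemma mloc_cst n (c : R) : mloc n (fun=> c).
Proof. by split. Qed.

Lemma mloc_comp n F (h : R -> R) : measurable_fun setT h -> mloc n F ->
  mloc n (fun x => h (F x)).
Proof.
move=> mh [mF lF]; split; first exact: measurableT_comp.
by move=> x y /lF ->.
Qed.

Lemma mlocD n F H : mloc n F -> mloc n H -> mloc n (fun x => F x + H x).
Proof.
move=> [mF lF] [mH lH]; split; first exact: measurable_funD.
by move=> x y xy; rewrite (lF _ _ xy) (lH _ _ xy).
Qed.

Lemma mlocB n F H : mloc n F -> mloc n H -> mloc n (fun x => F x - H x).
Proof.
move=> [mF lF] [mH lH]; split; first exact: measurable_funB.
by move=> x y xy; rewrite (lF _ _ xy) (lH _ _ xy).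
Qed.

Lemma mlocM n F H : mloc n F -> mloc n H -> mloc n (fun x => F x * H x).
Proof.
move=> [mF lF] [mH lH]; split; first exact: measurable_funM.
by move=> x y xy; rewrite (lF _ _ xy) (lH _ _ xy).
Qed.

Lemma mlocX n F k : mloc n F -> mloc n (fun x => F x ^+ k).
Proof.
have mk : measurable_fun [set: R] (fun y : R => y ^+ k) by exact: exprn_measurable.
exact: (mloc_comp n F _ mk).
Qed.

Lemma mlocV n F : mloc n F -> mloc n (fun x => (F x)^-1).
Proof.
have mi : measurable_fun [set: R] (@GRing.inv R).
  by apply: (measurable_inv (@id R)); exact: measurable_id.
exact: (mloc_comp n F _ mi).
Qed.

Lemma mloc_sum n k (F : 'I_k -> (nat -> R) -> R) : (forall i, mloc n (F i)) ->
  mloc n (fun x => \sum_i F i x).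
Proof.
move=> h; split; first by apply: measurable_sum => i; case: (h i).
by move=> x y xy; apply: eq_bigr => i _; case: (h i) => _; exact.
Qed.

Lemma mloc_sqsum n k : (k <= n)%N -> mloc n (sqsum R k).
Proof.
move=> kn; apply: mloc_sum => i; apply: mlocX; apply: mloc_coord.
exact: leq_trans kn.
Qed.

Lemma mloc_quartsum n k : (k <= n)%N -> mloc n (quartsum R k).
Proof.
move=> kn; apply: mloc_sum => i; apply: mlocX; apply: mloc_coord.
exact: leq_trans kn.
Qed.

Lemma mloc_kurt n k : (k <= n)%N -> mloc n (kurt R k).
Proof.
by move=> kn; apply: mlocM; [exact: mloc_quartsum|apply: mlocV; apply: mlocX; exact: mloc_sqsum].
Qed.

Lemma mev_le n F H : mloc n F -> mloc n H -> mev n [set x | F x <= H x].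
Proof.
move=> [mF lF] [mH lH]; split; first exact: measurable_le_set.
by move=> x y xy /=; rewrite (lF _ _ xy) (lH _ _ xy).
Qed.

Lemma mev_lt n F H : mloc n F -> mloc n H -> mev n [set x | F x < H x].
Proof.
move=> [mF lF] [mH lH]; split; first exact: measurable_lt_set.
by move=> x y xy /=; rewrite (lF _ _ xy) (lH _ _ xy).
Qed.

Lemma mevI n E E' : mev n E -> mev n E' -> mev n (E `&` E').
Proof.
move=> [mE lE] [mE' lE']; split; first exact: measurableI.
by move=> x y xy [Ex Ex']; split; [exact: lE Ex|exact: lE' Ex'].
Qed.

End LocalEvents.

Section IidEvents.
Context {d : measure_display} {Omega : measurableType d} {R : realType}.
Variables (P : probability Omega R) (S : nat -> Omega -> R).
Hypothesis iidS : iid P S.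
Implicit Types E : set (nat -> R).

Definition ev (f : nat -> nat) E : set Omega := [set w | E (fun i => S (f i) w)].

Lemma evE n f E : mev n E -> ev f E = vec S n f @^-1` [set t | E (nth 0 t)].
Proof.
move=> [_ lE]; have h w : agree_below n (fun i => S (f i) w) (nth 0 (vec S n f w)).
  by move=> i ni; rewrite -(tnth_nth 0 _ (Ordinal ni)) tnth_mktuple.
apply/seteqP; split=> w /=; first exact: lE.
by apply: lE => i ni; rewrite h.
Qed.

Lemma measurable_ev n f E : mev n E -> measurable (ev f E).
Proof. by move=> mE; rewrite (evE n)//; apply: measurable_vec_preimage iidS _ _ _ _; case: mE. Qed.

Lemma ev_law n f f' E : mev n E -> inj_below n f -> inj_below n f' ->
  pr P (ev f E) = pr P (ev f' E).
Proof.
move=> mE inj1 inj2; rewrite !(evE n)// /pr.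
by congr fine; apply: (vec_law _ _ iidS) => //; case: mE.
Qed.

Lemma ev_indep n E E' : mev n E -> mev n E' ->
  pr P (ev id E `&` ev (addn n) E') = pr P (ev id E) * pr P (ev id E').
Proof.
move=> mE mE'.
have i1 : inj_below n id by move=> i j.
have i2 : inj_below n (addn n) by move=> i j _ _; lia.
rewrite -(ev_law n (addn n) id E')//.
have m1 := measurable_ev n id E mE.
have m2 := measurable_ev n (addn n) E' mE'.
apply: EFin_inj; rewrite EFinM -!prE//; last exact: measurableI.
rewrite !(evE n)//; apply: (vec_indep _ _ iidS) => //; first by move=> i j; lia.
- by case: mE.
- by case: mE'.
Qed.

End IidEvents.

(** * Exchanging two blocks of observations *)

Section Swap.
Context {R : realType}.
Variable G : nat.
Implicit Types (u : {ffun 'I_G -> bool}) (x : nat -> R).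

Definition keep u (i : nat) : bool := if insub i is Some j then u j else true.

(** Exchanges the observations [g] and [G + g] for each [g < G] with [u g] false. As [keep] is true
    from [G] on, indices from [G + G] on stay fixed, and [swap u] is an involution of all of
    [nat]. *)
Definition swap u (i : nat) : nat :=
  if (i < G)%N then (if keep u i then i else G + i)%N
  else (if keep u (i - G) then i else i - G)%N.

Lemma keep_ord u (g : 'I_G) : keep u g = u g.
Proof. by rewrite /keep valK. Qed.

Lemma keep_ge u i : (G <= i)%N -> keep u i.
Proof. by move=> h; rewrite /keep insubF// ltnNge h. Qed.

Lemma swapK u : involutive (swap u).
Proof.
move=> i; have [hi|hi] := ltnP i G; have [hk|hk] := boolP (keep u (if (i < G)%N then i else i - G)%N).
- by rewrite hi in hk; rewrite /swap hi hk hi hk.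
- rewrite hi in hk; rewrite /swap hi (negbTE hk) ltnNge leq_addr /= addKn.
  by rewrite (negbTE hk).
- by rewrite ltnNge hi /= in hk; rewrite /swap (ltnNge i) hi /= hk (ltnNge i) hi /= hk.
rewrite ltnNge hi /= in hk.
have h : (i - G < G)%N by rewrite ltnNge; apply: contra hk; exact: keep_ge.
by rewrite /swap (ltnNge i) hi /= (negbTE hk) h (negbTE hk) subnKC.
Qed.

Lemma swap_inj u n : inj_below n (swap u).
Proof. by move=> i j _ _; exact: (inv_inj (swapK u)). Qed.

Definition gap (e : R -> R) x (g : nat) : R := e (x g) - e (x (G + g)%N).

Lemma gap_swap e x u (g : 'I_G) :
  gap e (fun i => x (swap u i)) g = rad R (u g) * gap e x g.
Proof.
rewrite /gap /swap ltn_ord ltnNge leq_addr /= addKn keep_ord /rad.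
by case: (u g); rewrite ?mul1r ?mulN1r ?opprB.
Qed.

Lemma sym_sum_swap (h : R -> R) x u :
  \sum_(g < G) (h (x (swap u g)) + h (x (swap u (G + g)%N))) =
  \sum_(g < G) (h (x g) + h (x (G + g)%N)).
Proof.
apply: eq_bigr => g _.
rewrite /swap ltn_ord ltnNge leq_addr /= addKn keep_ord.
by case: (u g) => //; rewrite addrC.
Qed.

Definition gap_event e (v : (nat -> R) -> R) (c lam : R) : set (nat -> R) :=
  [set x | \sum_(g < G) gap e x g ^+ 2 <= c * v x] `&`
  [set x | lam * v x < (\sum_(g < G) gap e x g) ^+ 2].

Lemma gap_event_swap e v c lam x u : v (fun i => x (swap u i)) = v x ->
  gap_event e v c lam (fun i => x (swap u i)) <->
  (\sum_(g < G) gap e x g ^+ 2 <= c * v x) /\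
  lam * v x < sign_sum R G (gap e x) u ^+ 2.
Proof.
move=> vx; rewrite /gap_event /= vx.
rewrite (eq_bigr (fun g : 'I_G => gap e x g ^+ 2)); last first.
  move=> g _; rewrite gap_swap exprMn (_ : rad R (u g) ^+ 2 = 1) ?mul1r//.
  by rewrite /rad; case: (u g); rewrite ?expr1n// sqrrN expr1n.
by rewrite (eq_bigr _ (fun g _ => gap_swap e x u g)).
Qed.

Lemma mloc_gap e (g : 'I_G) : measurable_fun setT e -> mloc (G + G) (fun x => gap e x g).
Proof.
move=> me; apply: mlocB; apply: mloc_comp => //; apply: mloc_coord.
  by rewrite ltn_addr.
by rewrite ltn_add2l.
Qed.

Lemma mev_gap_event e v c lam : measurable_fun setT e -> mloc (G + G) v ->
  mev (G + G) (gap_event e v c lam).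
Proof.
move=> me mv; apply: mevI.
  apply: mev_le; last by apply: mlocM => //; exact: mloc_cst.
  by apply: mloc_sum => g; apply: mlocX; exact: mloc_gap.
apply: mev_lt; first by apply: mlocM => //; exact: mloc_cst.
by apply: mlocX; apply: mloc_sum => g; exact: mloc_gap.
Qed.

Context {d : measure_display} {Omega : measurableType d}.
Variables (P : probability Omega R) (S : nat -> Omega -> R).
Hypothesis iidS : iid P S.

(* Swapping pairs of observations preserves the law and multiplies the gaps by
   arbitrary signs, so Chebyshev for sign sums applies conditionally. *)
Lemma pr_gap_event e v c lam : measurable_fun setT e -> mloc (G + G) v ->
  (forall x, 0 <= v x) -> (forall u x, v (fun i => x (swap u i)) = v x) ->
  0 <= c -> 0 < lam -> pr P (ev S id (gap_event e v c lam)) <= c / lam.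
Proof.
move=> me mv v0 vs c0 l0; set E := gap_event e v c lam.
have mE : mev (G + G) E by exact: mev_gap_event.
(* All summands are equal by exchangeability, so this averaged bound is the claim; at a fixed data
   point it is Chebyshev over the [2 ^+ G] sign vectors. *)
have h : \sum_(u : {ffun 'I_G -> bool}) pr P (ev S (swap u) E) <= 2 ^+ G * (c / lam).
  apply: sum_pr_le => [u|w]; first exact: (measurable_ev _ _ iidS (G + G)).
  set x : nat -> R := fun i => S i w.
  have EP u : (\1_(ev S (swap u) E) w : R) =
      ((\sum_(g < G) gap e x g ^+ 2 <= c * v x) &&
       (lam * v x < sign_sum R G (gap e x) u ^+ 2))%:R.
    rewrite indicE; congr ((nat_of_bool _)%:R); apply/idP/idP; rewrite inE.
      by move/(gap_event_swap e v c lam x u (vs u x)) => [-> ->].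
    by move=> /andP[? ?]; apply/(gap_event_swap e v c lam x u (vs u x)).
  rewrite (eq_bigr _ (fun u _ => EP u)).
  have K0 : 0 <= 2 ^+ G * (c / lam) by rewrite mulr_ge0 ?divr_ge0 ?exprn_ge0// ltW.
  case: (leP (\sum_(g < G) _) (c * v x)) => hs; last by rewrite big1.
  have hsum := sum_sign_sqr R G (gap e x).
  have hle : \sum_(u : {ffun 'I_G -> bool})
      (lam * v x) * (lam * v x < sign_sum R G (gap e x) u ^+ 2)%R%:R <= 2 ^+ G * (c * v x).
    apply: le_trans (_ : 2 ^+ G * (\sum_(g < G) gap e x g ^+ 2) <= _).
      rewrite -hsum; apply: ler_sum => u _; case: ltP => [/ltW|_]; first by rewrite mulr1.
      by rewrite mulr0 sqr_ge0.
    by rewrite ler_wpM2l// exprn_ge0.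
  (* On a vanishing scale all gaps vanish, and the strict inequality in the event fails. *)
  have := v0 x; rewrite le_eqVlt => /predU1P[vx|vx].
    rewrite big1// => u _; rewrite /= -vx mulr0.
    have : sign_sum R G (gap e x) u ^+ 2 <= 0.
      rewrite -vx mulr0 in hs.
      apply: le_trans (_ : \sum_(b : {ffun 'I_G -> bool}) sign_sum R G (gap e x) b ^+ 2 <= _).
        rewrite (bigD1 u) //= lerDl; apply: sumr_ge0 => b _; exact: sqr_ge0.
      by rewrite hsum mulr_ge0_le0 ?exprn_ge0.
    by rewrite leNgt => /negbTE ->.
  rewrite -big_distrr /= in hle.
  rewrite -(ler_pM2l (mulr_gt0 l0 vx)); apply: (le_trans hle).
  rewrite le_eqVlt; apply/orP; left; apply/eqP; field.
  by rewrite gt_eqF.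
rewrite (eq_bigr (fun=> pr P (ev S id E))) in h; last first.
  by move=> u _; apply: (ev_law _ _ iidS (G + G)) => //; exact: swap_inj.
by rewrite sum_sign_const ler_pM2l ?exprn_gt0// in h.
Qed.

End Swap.

(** * Growth of the sum of squares *)

Section Core.
Context {d : measure_display} {Omega : measurableType d} {R : realType}.
Variables (P : probability Omega R) (S : nat -> Omega -> R).
Hypothesis iidS : iid P S.

Let mS g : measurable_fun setT (S g). Proof. by case: iidS. Qed.

Definition rv (F : nat -> (nat -> R) -> R) (f : nat -> nat) n (w : Omega) : R :=
  F n (fun i => S (f i) w).

Definition total n (x : nat -> R) : R := \sum_(i < n) x i.

Local Notation U := (rv (sqsum R)).
Local Notation kap := (rv (kurt R)).
Local Notation W := (rv total).

Lemma measurable_rv_sqsum f n : measurable_fun setT (U f n).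
Proof. by apply: measurable_sum => i; apply: measurable_funX; exact: mS. Qed.

Lemma measurable_rv_kurt f n : measurable_fun setT (kap f n).
Proof.
apply: measurable_funM; last by apply: measurable_inv; apply: measurable_funX;
  exact: measurable_rv_sqsum.
by apply: measurable_sum => i; apply: measurable_funX; exact: mS.
Qed.

Lemma measurable_rv_total f n : measurable_fun setT (W f n).
Proof. by apply: measurable_sum => i; exact: mS. Qed.

Hint Resolve measurable_rv_sqsum measurable_rv_kurt measurable_rv_total : core.

Lemma mloc_total n k : (k <= n)%N -> mloc n (total k).
Proof. by move=> kn; apply: mloc_sum => i; apply: mloc_coord; exact: leq_trans kn. Qed.

Lemma U_ge0 f n w : 0 <= U f n w. Proof. exact: sqsum_ge0. Qed.

Lemma sqsumD n x : sqsum R (n + n) x = sqsum R n x + sqsum R n (fun i => x (n + i)%N).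
Proof. by rewrite /sqsum big_split_ord. Qed.

Lemma quartsumD n x :
  quartsum R (n + n) x = quartsum R n x + quartsum R n (fun i => x (n + i)%N).
Proof. by rewrite /quartsum big_split_ord. Qed.

Lemma U_double n w : U id (n + n) w = U id n w + U (addn n) n w.
Proof. exact: sqsumD. Qed.

Lemma U_mono m n w : (m <= n)%N -> U id m w <= U id n w.
Proof.
move=> mn; rewrite -(subnKC mn) /rv /sqsum big_split_ord /= lerDl.
by apply: sumr_ge0 => i _; exact: sqr_ge0.
Qed.

Lemma inj_id n : inj_below n id. Proof. by move=> i j. Qed.
Lemma inj_addn n m : inj_below n (addn m). Proof. by move=> i j _ _; lia. Qed.
Hint Resolve inj_id inj_addn : core.

(** [U] over two blocks is a sum of nonnegative independent parts, so both must be small. Iterated,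
    this turns a probability below 1 into one close to 0. *)
Lemma pr_U_double n x :
  pr P [set w | U id (n + n) w <= x] <= pr P [set w | U id n w <= x] ^+ 2.
Proof.
have mE : mev n [set y : nat -> R | sqsum R n y <= x].
  by apply: mev_le; [exact: mloc_sqsum|exact: mloc_cst].
rewrite expr2 -(ev_indep P S iidS n _ _ mE mE); apply: pr_le.
- exact: measurable_le_set.
- by apply: measurableI; exact: (measurable_ev P S iidS n _ _ mE).
move=> w /=; rewrite U_double => h; split; rewrite /ev /=; apply: le_trans h.
  by rewrite lerDl U_ge0.
by rewrite lerDr U_ge0.
Qed.

Lemma double_expn k n : (2 ^ k.+1 * n = 2 ^ k * n + 2 ^ k * n)%N.
Proof. by rewrite expnS -mulnA mul2n addnn. Qed.

Lemma pr_U_pow k n x :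
  pr P [set w | U id (2 ^ k * n) w <= x] <= pr P [set w | U id n w <= x] ^+ (2 ^ k).
Proof.
elim: k => [|k IH]; first by rewrite mul1n expr1.
rewrite double_expn; apply: (le_trans (pr_U_double _ _)).
rewrite expnSr exprM; apply: sqr_le => //; exact: pr_ge0.
Qed.

Variables (A D : nat -> R).

Hypothesis A_gt0 : forall n, (0 < n)%N -> 0 < A n.

(** * Lower bound of order [A n ^+ 2] for [U] by symmetrisation *)

Section Lower.
Variables (y1 y2 p : R) (n0 : nat).
Hypotheses (y12 : y1 < y2) (p0 : 0 < p).
Hypothesis low : forall n, (n0 <= n)%N -> p <= pr P [set w | W id n w <= D n + y1 * A n].
Hypothesis high : forall n, (n0 <= n)%N -> p <= pr P [set w | D n + y2 * A n < W id n w].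

(** With probability at least [p ^+ 2] the totals of two independent blocks differ by more than
    [(y2 - y1) A n], as [D n] cancels. By [pr_gap_event] at least half of this probability remains
    where the squared gaps sum to more than [c]; one block then has [U >= c / 4], and equality in
    law of the blocks leaves [p ^+ 2 / 4]. *)
Let lower_n n : (0 < n)%N -> (n0 <= n)%N ->
  p ^+ 2 / 4 <= pr P [set w | (y2 - y1) ^+ 2 * p ^+ 2 / 8 * A n ^+ 2 <= U id n w].
Proof.
move=> n1 nn0; have An := A_gt0 _ n1.
have dA : 0 < (y2 - y1) * A n by rewrite mulr_gt0// subr_gt0.
have p2 : 0 < p ^+ 2 by rewrite exprn_gt0.
pose lam := ((y2 - y1) * A n) ^+ 2.
have lam0 : 0 < lam by rewrite exprn_gt0.
pose c := lam * p ^+ 2 / 2.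
have c0 : 0 <= c by rewrite /c divr_ge0// mulr_ge0// ltW.
have mE1 : mev n [set x : nat -> R | total n x <= D n + y1 * A n].
  by apply: mev_le; [exact: mloc_total|exact: mloc_cst].
have mE2 : mev n [set x : nat -> R | D n + y2 * A n < total n x].
  by apply: mev_lt; [exact: mloc_cst|exact: mloc_total].
have ind := ev_indep P S iidS n _ _ mE1 mE2.
have mid : measurable_fun [set: R] (@id R) by exact: measurable_id.
have gapE := pr_gap_event n P S iidS id (fun=> 1) c lam mid
  (mloc_cst _ 1) (fun=> ler01) (fun _ _ => erefl) c0 lam0.
set cn := (X in X <= _ _ _); set E := [set w | _ <= _] in cn *.
have cE : (y2 - y1) ^+ 2 * p ^+ 2 / 8 * A n ^+ 2 = c / 4.
  by rewrite /c /lam; field.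
have mE : measurable E by exact: measurable_le_set.
have mE' : measurable [set w | c / 4 <= U (addn n) n w] by exact: measurable_le_set.
have lawE : pr P [set w | c / 4 <= U (addn n) n w] = pr P E.
  rewrite /E cE; apply: (ev_law P S iidS n (addn n) id [set x | c / 4 <= sqsum R n x]) => //.
  by apply: mev_le; [exact: mloc_cst|exact: mloc_sqsum].
have mG : measurable (ev S id (gap_event n id (fun=> 1) c lam)).
  apply: (measurable_ev P S iidS (n + n)); apply: mev_gap_event.
    exact: mid.
  exact: mloc_cst.
set E12 := ev S id _ `&` _ in ind.
have mE12 : measurable E12.
  by apply: measurableI; [exact: (measurable_ev P S iidS n _ _ mE1)|exact: (measurable_ev P S iidS n _ _ mE2)].
have sub : E12 `<=` ev S id (gap_event n id (fun=> 1) c lam) `|`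
    (E `|` [set w | c / 4 <= U (addn n) n w]).
  move=> w [/= h1 h2].
  have [hs|hs] := leP (\sum_(g < n) gap n id (fun i => S i w) g ^+ 2) c; [left|right].
    rewrite /gap_event /ev /=; split; rewrite ?mulr1//.
    rewrite /gap sumrB -/(total n (fun i => S i w)).
    rewrite -[\sum_(i < n) S (n + i)%N w]/(total n (fun i => S (n + i)%N w)).
    rewrite -sqrrN; rewrite /lam; move: h1 h2; rewrite /ev /=; nra.
  have : c < 2 * U id n w + 2 * U (addn n) n w.
    apply: (lt_le_trans hs); rewrite /rv /sqsum !big_distrr -big_split /=.
    apply: ler_sum => g _; rewrite /gap.
    by have := sqr_ge0 (S g w + S (n + g)%N w); nra.
  have [h|h] := leP (c / 4) (U id n w); first by move=> _; left; rewrite /E /= cE.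
  by move=> hh; right => /=; lra.
have mEE' := measurableU _ _ mE mE'.
have := pr_cover P _ _ _ _ _ mE12 mG mEE' sub gapE (prU P _ _ mE mE').
rewrite lawE ind (_ : c / lam = p ^+ 2 / 2); last first.
  by rewrite /c; field; rewrite gt_eqF.
have := ler_pM (ltW p0) (ltW p0) (low _ nn0) (high _ nn0).
rewrite -expr2 /rv /ev /cn /=; lra.
Qed.

Lemma U_lower : exists c2 p2 : R, exists n1 : nat, [/\ 0 < c2, 0 < p2 &
  forall n, (n1 <= n)%N -> p2 <= pr P [set w | c2 * A n ^+ 2 <= U id n w]].
Proof.
exists ((y2 - y1) ^+ 2 * p ^+ 2 / 8), (p ^+ 2 / 4), (maxn 1 n0); split.
- by rewrite divr_gt0// mulr_gt0// exprn_gt0// subr_gt0.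
- by rewrite divr_gt0// exprn_gt0.
- by move=> n; rewrite geq_max => /andP[n1 nn0]; exact: lower_n.
Qed.

End Lower.

Lemma expn_small (q eta : R) : 0 <= q < 1 -> 0 < eta ->
  exists k, q ^+ (2 ^ k) < eta.
Proof.
move=> /andP[q0 q1] eta0.
have : (fun k => q ^+ k) @ \oo --> (0 : R).
  by apply: cvg_expr; rewrite ger0_norm.
move/cvgrPdist_lt/(_ _ eta0) => [k _ hk].
have k2 : (k <= 2 ^ k)%N by rewrite ltnW// ltn_expl.
exists k; have := hk (2 ^ k)%N k2.
by rewrite /= sub0r normrN ger0_norm// exprn_ge0.
Qed.

(** * Tightness of [U], balance of the blocks, and the contradiction *)

Section Concentration.
Variables (c2 p2 : R) (n2 : nat).
Hypotheses (c20 : 0 < c2) (p20 : 0 < p2).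
Hypothesis lowU : forall n, (n2 <= n)%N ->
  p2 <= pr P [set w | c2 * A n ^+ 2 <= U id n w].

Lemma U_gt0_whp (eta : R) : 0 < eta -> exists n1 : nat, forall n, (n1 <= n)%N ->
  pr P [set w | U id n w <= 0] <= eta.
Proof.
move=> eta0; pose m := maxn 1 n2.
have m0 : (0 < m)%N by rewrite leq_max.
have q1 : pr P [set w | U id m w <= 0] <= 1 - p2.
  have mE : measurable [set w | c2 * A m ^+ 2 <= U id m w] by exact: measurable_le_set.
  have := lowU m (leq_maxr _ _); rewrite -[X in X <= _]opprK lerNl -(lerD2l 1) -prC//.
  apply: le_trans; apply: pr_le; first exact: measurable_le_set.
    exact: measurableC.
  move=> w /= h; apply/negP; rewrite -ltNge; apply: (le_lt_trans h).
  by rewrite mulr_gt0// exprn_gt0// A_gt0.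
have [k hk] : exists k, pr P [set w | U id m w <= 0] ^+ (2 ^ k) < eta.
  apply: expn_small => //; rewrite pr_ge0 /=; apply: (le_lt_trans q1).
  by rewrite gtrBl.
exists (2 ^ k * m)%N => n mn; apply: le_trans (ltW hk).
apply: le_trans (pr_U_pow _ _ _); apply: pr_le; try exact: measurable_le_set.
by move=> w /=; apply: le_trans; exact: U_mono.
Qed.

Variable s : R.
Hypothesis s2 : 2 < s.
Hypothesis scal : forall k, exists n1 : nat, forall n, (n1 <= n)%N ->
  s ^+ k / 2 * A n ^+ 2 <= A (2 ^ k * n)%N ^+ 2 <= 2 * s ^+ k * A n ^+ 2.

Section Tight.
Variables (C1 p1 : R) (n1 : nat).
Hypotheses (C10 : 0 < C1) (p10 : 0 < p1).
Hypothesis upU : forall n, (n1 <= n)%N ->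
  p1 <= pr P [set w | U id n w <= C1 * A n ^+ 2].

(** Amplification read backwards: if [U id n] exceeded a level with probability above [eta], then
    [U] over [2 ^ k] blocks would stay below it with probability less than [p1]. By [scal] the level
    [C1 * A (2 ^ k * n) ^+ 2] is still of order [A n ^+ 2]. *)
Lemma U_tight (eta : R) : 0 < eta -> exists C : R, exists2 n3 : nat, 0 < C &
  forall n, (n3 <= n)%N -> pr P [set w | C * A n ^+ 2 < U id n w] <= eta.
Proof.
move=> eta0.
have [k hk] : exists k, (Num.max 0 (1 - eta)) ^+ (2 ^ k) < p1.
  by apply: expn_small => //; rewrite le_max lexx /= gt_max ltr01 /= gtrBl.
have [n3 hn3] := scal k.
exists (C1 * (2 * s ^+ k)), (maxn n1 n3).
  by rewrite mulr_gt0// mulr_gt0// exprn_gt0//; have := s2; lra.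
move=> n; rewrite geq_max => /andP[nn1 /hn3 /andP[_ hA]].
have nk : (n1 <= 2 ^ k * n)%N by rewrite (leq_trans nn1)// leq_pmull// expn_gt0.
set x := C1 * A (2 ^ k * n)%N ^+ 2.
have hq : p1 <= pr P [set w | U id n w <= x] ^+ (2 ^ k).
  exact: le_trans (upU _ nk) (pr_U_pow _ _ _).
have mE : measurable [set w | U id n w <= x] by exact: measurable_le_set.
have h1 : 1 - eta <= pr P [set w | U id n w <= x].
  rewrite leNgt; apply/negP => h.
  have : pr P [set w | U id n w <= x] ^+ (2 ^ k) <= Num.max 0 (1 - eta) ^+ (2 ^ k).
    by rewrite lerXn2r ?nnegrE ?pr_ge0 ?le_max ?lexx// (ltW h) orbT.
  by move/(le_trans hq)/le_lt_trans/(_ hk); rewrite ltxx.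
apply: (@le_trans _ _ (pr P (~` [set w | U id n w <= x]))); last by rewrite prC//; lra.
apply: pr_le; [exact: measurable_lt_set|exact: measurableC|].
move=> w /= h; apply/negP; rewrite -ltNge; apply: le_lt_trans h.
by rewrite /x -mulrA ler_wpM2l// ltW.
Qed.

End Tight.

Hypothesis tightU : forall eta : R, 0 < eta -> exists C : R, exists2 n3 : nat, 0 < C &
  forall n, (n3 <= n)%N -> pr P [set w | C * A n ^+ 2 < U id n w] <= eta.

(* Pigeonhole: U / A^2 charges some cell of a fixed finite partition, and two
   independent copies fall simultaneously in that cell. *)
Lemma U_close (e : R) : 0 < e -> exists c : R, exists2 n4 : nat, 0 < c &
  forall n, (n4 <= n)%N -> c <= pr P [set w |
    (0 < U id n w) && (`|U id n w - U (addn n) n w| <= e * (U id n w + U (addn n) n w))].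
Proof.
move=> e0; have [C [n3 C0 hC]] := tightU (p2 / 2) (divr_gt0 p20 (ltr0n R 2)).
(* Cells of width [c2 e A^2] starting at [c2 A^2]: two points of one cell differ by at most [e]
   times a lower bound of [U], and [J] cells reach beyond [C A^2]. *)
pose J := (Num.truncn (C / (c2 * e))).+1.
have J0 : 0 < J%:R :> R by rewrite ltr0n.
have hJ : C <= J%:R * (c2 * e).
  rewrite -ler_pdivrMr ?mulr_gt0//; apply: ltW.
  by have /andP[] := truncn_itv (ltW (divr_gt0 C0 (mulr_gt0 c20 e0))).
exists ((p2 / (2 * J%:R)) ^+ 2), (maxn 1 (maxn n2 n3)).
  by rewrite exprn_gt0// divr_gt0// mulr_gt0.
move=> n; rewrite !geq_max => /andP[n1 /andP[/lowU hl /hC hu]].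
have A20 : 0 < A n ^+ 2 by rewrite exprn_gt0// A_gt0.
set h := c2 * e * A n ^+ 2; have h0 : 0 < h by apply: mulr_gt0 => //; exact: mulr_gt0.
pose cell (j : nat) : set (nat -> R) := [set x | c2 * A n ^+ 2 + j%:R * h <= sqsum R n x]
  `&` [set x | sqsum R n x <= c2 * A n ^+ 2 + j.+1%:R * h].
have mcell j : mev n (cell j).
  by apply: mevI; apply: mev_le; (try exact: mloc_cst); exact: mloc_sqsum.
have mc j : measurable (ev S id (cell j)) := measurable_ev P S iidS n _ _ (mcell j).
have m1 : measurable [set w | c2 * A n ^+ 2 <= U id n w] by exact: measurable_le_set.
have m2 : measurable [set w | C * A n ^+ 2 < U id n w] by exact: measurable_lt_set.
have mJ : measurable (\big[setU/set0]_(j < J) ev S id (cell j)) by exact: bigsetU_measurable.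
have sub : [set w | c2 * A n ^+ 2 <= U id n w] `<=`
    \big[setU/set0]_(j < J) ev S id (cell j) `|` [set w | C * A n ^+ 2 < U id n w].
  move=> w /= hw; have [hCw|hCw] := ltP (C * A n ^+ 2) (U id n w); [by right|left].
  pose j := Num.truncn ((U id n w - c2 * A n ^+ 2) / h).
  have q0 : 0 <= (U id n w - c2 * A n ^+ 2) / h by rewrite divr_ge0 ?subr_ge0// ltW.
  have /andP[j1 j2] := truncn_itv q0; rewrite -/j in j1 j2.
  rewrite ler_pdivlMr// in j1; rewrite ltr_pdivrMr// in j2.
  have jJ : (j < J)%N.
    rewrite -(ltr_nat R) -(ltr_pM2r h0); apply: le_lt_trans j1 _.
    have : C * A n ^+ 2 <= J%:R * h by rewrite /h mulrA ler_wpM2r// ltW.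
    have : 0 < c2 * A n ^+ 2 by rewrite mulr_gt0.
    lra.
  rewrite -(bigcup_mkord J (fun j => ev S id (cell j))); exists j => //; rewrite /ev /cell /=; rewrite /rv in j1 j2.
  by split; [lra|apply: ltW; lra].
have hsum : p2 / 2 <= \sum_(j < J) pr P (ev S id (cell j)).
  have := pr_cover P _ _ _ _ _ m1 mJ m2 sub (pr_bigU P J _ mc) hu.
  by move/(le_trans hl); lra.
have [j hj] : exists j : 'I_J, p2 / (2 * J%:R) <= pr P (ev S id (cell j)).
  apply: contrapT => hn.
  have hlt (j : 'I_J) : pr P (ev S id (cell j)) < p2 / (2 * J%:R).
    by rewrite ltNge; apply/negP => ?; apply: hn; exists j.
  move: hsum; apply/negP; rewrite -ltNge.
  apply: (@lt_le_trans _ _ (\sum_(j < J) p2 / (2 * J%:R))).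
    by apply: ltr_sum => //; apply/hasP; exists ord0; rewrite ?mem_index_enum.
  rewrite sumr_const card_ord -mulr_natl le_eqVlt; apply/orP; left; apply/eqP.
  by field; rewrite gt_eqF.
apply: le_trans (_ : pr P (ev S id (cell j)) ^+ 2 <= _).
  by apply: sqr_le => //; rewrite divr_ge0 ?mulr_ge0// ltW.
rewrite expr2 -(ev_indep P S iidS n _ _ (mcell j) (mcell j)); apply: pr_le.
- by apply: measurableI => //; exact: (measurable_ev P S iidS n _ _ (mcell j)).
- rewrite [X in measurable X](_ : _ = [set w | 0 < U id n w] `&`
    [set w | `|U id n w - U (addn n) n w| <= e * (U id n w + U (addn n) n w)]).
    apply: measurableI; first exact: measurable_lt_set.
    apply: measurable_le_set.
      by apply: measurableT_comp => //; exact: measurable_funB.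
    by apply: measurable_funM => //; exact: measurable_funD.
  by apply/seteqP; split=> w /=; [move=> /andP|move=> h'; apply/andP].
move=> w [[a1 a2] [b1 b2]] /=; rewrite /ev /cell /= in a1 a2 b1 b2.
rewrite -/(U id n w) in a1 a2; rewrite -/(U (addn n) n w) in b1 b2.
rewrite -natr1 in a2 b2.
have jh : 0 <= j%:R * h by rewrite mulr_ge0// ltW.
have cA : 0 < c2 * A n ^+ 2 by rewrite mulr_gt0.
apply/andP; split; first lra.
apply: (@le_trans _ _ h); first by rewrite ler_norml; apply/andP; split; nra.
rewrite /h -mulrA mulrCA ler_wpM2l ?(ltW e0)//; have := U_ge0 (addn n) n w; lra.
Qed.

Definition balanced n (tau : R) := pr P [set w |
  tau * (U id n w + U (addn n) n w) < `|U id n w - U (addn n) n w|] <= tau.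

Lemma measurable_unbalanced n tau : measurable [set w |
  tau * (U id n w + U (addn n) n w) < `|U id n w - U (addn n) n w|].
Proof.
apply: measurable_lt_set.
  by apply: measurable_funM => //; exact: measurable_funD.
by apply: measurableT_comp => //; exact: measurable_funB.
Qed.

Lemma measurable_dist f n (k tau : R) : measurable [set w | tau < `|kap f n w - k|].
Proof.
apply: measurable_lt_set => //; apply: measurableT_comp => //.
exact: measurable_funB.
Qed.

Hypothesis kurt_conc : forall tau : R, 0 < tau -> exists n5 : nat, forall n, (n5 <= n)%N ->
  exists k : R, pr P [set w | tau < `|kap id n w - k|] <= tau.

Lemma pr_meet (B E : set Omega) (b : R) : measurable B -> measurable E ->
  pr P B <= b -> b < pr P E -> exists2 w, E w & ~ B w.
Proof.
move=> mB mE hB hE.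
have [//|hn] := pselect (exists2 w, E w & ~ B w).
have : pr P E <= pr P B.
  apply: pr_le => // w Ew; apply: contrapT => Bw; apply: hn; by exists w.
by move=> h; move: (le_lt_trans (le_trans h hB) hE); rewrite ltxx.
Qed.

(** With [s = U1 + U2] and [D = U1 - U2], the block identity reads [2 k2 s^2 = k1 (s^2 + D^2)] up to
    small errors. So [D^2 / s^2] is nearly the same at all good sample points, and one point from
    [U_close] shows that it is small. The same relation makes [k2] at least about [k1 / 2], so a
    lower bound on [kurt] survives with [eta / 4]. *)
Lemma balance_step (eta tau : R) : 0 < eta -> 0 < tau <= 1 ->
  exists n6 : nat, forall n, (n6 <= n)%N ->
  1 / 2 <= pr P [set w | eta <= kap id n w] ->
  balanced n tau /\ 1 / 2 <= pr P [set w | eta / 4 <= kap id (n + n) w].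
Proof.
move=> eta0 /andP[tau0 tau1]; pose e := tau / 2.
have e0 : 0 < e by rewrite divr_gt0.
have e1 : e <= 1 / 2 by rewrite /e; lra.
have [c [n4 c0 hc]] := U_close e e0.
(* The exceptional probability is at most [3 t], which must stay below 1/2, [c] and [tau]; the terms
   in [eta] keep [k1 >= eta / 2] and give [8 t <= k1 * e ^+ 2]. *)
pose t := Num.min (Num.min (1 / 16) (c / 4)) (Num.min (eta / 16) (Num.min (e ^+ 2 * eta / 16) (tau / 4))).
have t0 : 0 < t.
  rewrite !lt_min; repeat (apply/andP; split); rewrite ?divr_gt0 ?mulr_gt0 ?exprn_gt0//; lra.
have : t <= t by [].
rewrite {2}/t !le_min => /andP[/andP[t16 tc] /andP[teta /andP[te ttau]]].
have [n5 h5] := kurt_conc t t0.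
exists (maxn n4 n5) => n; rewrite geq_max => /andP[/hc{}hc nn5] hk.
have [k1 hk1] := h5 n nn5.
have [k2 hk2] := h5 (n + n)%N (leq_trans nn5 (leq_addr _ _)).
have mB1 := measurable_dist id n k1 t.
have mB2 := measurable_dist (addn n) n k1 t.
have mB3 := measurable_dist id (n + n)%N k2 t.
have hk1' : pr P [set w | t < `|kap (addn n) n w - k1|] <= t.
  apply: le_trans hk1.
  have hm : mev n [set x : nat -> R | t < `|kurt R n x - k1|].
    apply: mev_lt; first exact: mloc_cst.
    have mn : measurable_fun [set: R] (fun y : R => `|y - k1|).
      by apply: measurableT_comp => //; exact: measurable_funB.
    exact: (mloc_comp n _ _ mn (mloc_kurt n n (leqnn n))).
  by rewrite (ev_law P S iidS n (addn n) id _ hm).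
have mke m (x : R) : measurable [set w | x <= kap id m w] by exact: measurable_le_set.
set B := [set w | t < `|kap id n w - k1|] `|` ([set w | t < `|kap (addn n) n w - k1|]
  `|` [set w | t < `|kap id (n + n)%N w - k2|]).
have mB : measurable B by do 2 apply: measurableU => //.
have hB : pr P B <= 3 * t.
  rewrite (_ : 3 * t = t + (t + t)); last by ring.
  apply: (pr_cover P _ _ _ _ _ mB mB1 (measurableU _ _ mB2 mB3)) => //.
  by apply: (le_trans (prU P _ _ mB2 mB3)); rewrite lerD.
have good w : ~ B w -> [/\ k1 - t <= kap id n w <= k1 + t,
    k1 - t <= kap (addn n) n w <= k1 + t & k2 - t <= kap id (n + n)%N w <= k2 + t].
  move=> nB; have [a [b a']] : [/\ `|kap id n w - k1| <= t,
      `|kap (addn n) n w - k1| <= t & `|kap id (n + n)%N w - k2| <= t].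
    by split; rewrite leNgt; apply/negP => h; apply: nB; [left|right; left|right; right].
  by move: a b a'; rewrite !ler_distl.
have k1eta : eta - t <= k1.
  have [|w /= hw nB] := pr_meet _ _ (3 * t) mB (mke n eta) hB.
    by apply: lt_le_trans hk; lra.
  by have [/andP[? ?] _ _] := good _ nB; lra.
have quart w : kap id (n + n)%N w * (U id n w + U (addn n) n w) ^+ 2 =
    kap id n w * U id n w ^+ 2 + kap (addn n) n w * U (addn n) n w ^+ 2.
  by rewrite -U_double /rv !kurt_eq quartsumD.
have ineq w : ~ B w -> let s := U id n w + U (addn n) n w in
    let D := U id n w - U (addn n) n w in
    (k1 - t) * (s ^+ 2 + D ^+ 2) <= 2 * (k2 + t) * s ^+ 2 /\
    2 * (k2 - t) * s ^+ 2 <= (k1 + t) * (s ^+ 2 + D ^+ 2) /\ D ^+ 2 <= s ^+ 2.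
  move=> /good[/andP[a1 a2] /andP[b1 b2] /andP[c1 c2']] /=.
  move: (quart w) (U_ge0 id n w) (U_ge0 (addn n) n w).
  move: (U id n w) (U (addn n) n w) (kap id n w) (kap (addn n) n w) (kap id (n + n)%N w)
    a1 a2 b1 b2 c1 c2' => u v a b q a1 a2 b1 b2 c1 c2' hq u0 v0.
  have s0 : 0 <= (u + v) ^+ 2 by exact: sqr_ge0.
  have u2 : 0 <= u ^+ 2 by exact: sqr_ge0.
  have v2 : 0 <= v ^+ 2 by exact: sqr_ge0.
  have -> : (u + v) ^+ 2 + (u - v) ^+ 2 = 2 * (u ^+ 2 + v ^+ 2) by ring.
  have x1 := ler_wpM2r s0 c1; have x2 := ler_wpM2r s0 c2'.
  have x3 := ler_wpM2r u2 a1; have x4 := ler_wpM2r u2 a2.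
  have x5 := ler_wpM2r v2 b1; have x6 := ler_wpM2r v2 b2.
  have x7 := mulr_ge0 u0 v0.
  split; first by lra.
  by split; [lra|nra].
have mC : measurable [set w | (0 < U id n w) &&
    (`|U id n w - U (addn n) n w| <= e * (U id n w + U (addn n) n w))].
  rewrite [X in measurable X](_ : _ = [set w | 0 < U id n w] `&`
    [set w | `|U id n w - U (addn n) n w| <= e * (U id n w + U (addn n) n w)]).
    apply: measurableI; first exact: measurable_lt_set.
    apply: measurable_le_set.
      by apply: measurableT_comp => //; exact: measurable_funB.
    by apply: measurable_funM => //; exact: measurable_funD.
  by apply/seteqP; split=> w /=; [move=> /andP|move=> h'; apply/andP].
have [|w0 /= /andP[u0 hD0] nB0] := pr_meet _ _ (3 * t) mB mC hB.
  by apply: lt_le_trans hc; lra.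
have [i1 [i2 i3]] := ineq _ nB0.
have s0 : 0 < (U id n w0 + U (addn n) n w0) ^+ 2.
  by rewrite exprn_gt0//; have := U_ge0 (addn n) n w0; lra.
have D0 : (U id n w0 - U (addn n) n w0) ^+ 2 <=
    e ^+ 2 * (U id n w0 + U (addn n) n w0) ^+ 2.
  by rewrite -exprMn -[leLHS]real_normK ?num_real//; apply: sqr_le.
move: i1 i2 i3 s0 D0; cbv zeta.
set s0 := (U id n w0 + _) ^+ 2; set D0 := (U id n w0 - _) ^+ 2 => i1 i2 i3 s00 hD.
have D00 : 0 <= D0 by exact: sqr_ge0.
have k1t : 0 <= k1 - t by lra.
have k2up : 2 * (k2 - t) <= (k1 + t) * (1 + e ^+ 2).
  rewrite -(ler_pM2r s00); apply: (le_trans i2).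
  rewrite -[leRHS]mulrA ler_wpM2l//; lra.
have k2low : k1 - t <= 2 * (k2 + t).
  rewrite -(ler_pM2r s00); apply: le_trans i1.
  by rewrite ler_wpM2l// lerDl.
split.
  apply: (@le_trans _ _ (3 * t)); last lra.
  apply: le_trans hB; apply: pr_le => //; first exact: measurable_unbalanced.
  move=> w /= hw; apply: contrapT => nB.
  have [j1 [j2 j3]] := ineq _ nB.
  have s1 : 0 <= U id n w + U (addn n) n w by rewrite addr_ge0 ?U_ge0.
  have hw2 : tau ^+ 2 * (U id n w + U (addn n) n w) ^+ 2 <
      (U id n w - U (addn n) n w) ^+ 2.
    rewrite -exprMn -[ltRHS]real_normK ?num_real// ltrXn2r//.
    by rewrite mulr_ge0// ltW.
  move: j1 j2 j3 hw2; cbv zeta.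
  set sg := (U id n w + _) ^+ 2; set D1 := (U id n w - _) ^+ 2 => j1 j2 j3 hw2.
  have s20 : 0 <= sg by exact: sqr_ge0.
  have D20 : 0 <= D1 by exact: sqr_ge0.
  have k10 : 0 < k1 by lra.
  have e2 : e ^+ 2 <= 1 / 4 by nra.
  (* Eliminates [k2] between the inequality at [w] and the bound [k2up] obtained at the single point
     [w0]. *)
  have f1 : k1 * D1 <= (8 * t + k1 * e ^+ 2) * sg.
    have g1 := ler_wpM2r s20 k2up.
    have g2 := mulr_ge0 (ltW t0) s20.
    have g3 : t * D1 <= t * sg by rewrite ler_wpM2l// ltW.
    have g4 : t * e ^+ 2 * sg <= t * sg by rewrite ler_wpM2r// ler_piMr ?(ltW t0)//; lra.
    nra.
  have f2 : 8 * t <= k1 * e ^+ 2.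
    have : eta / 2 * e ^+ 2 <= k1 * e ^+ 2 by rewrite ler_wpM2r ?sqr_ge0//; lra.
    lra.
  have f3 : k1 * D1 <= k1 * (2 * e ^+ 2 * sg).
    apply: (le_trans f1); rewrite (_ : k1 * (2 * e ^+ 2 * sg) = (k1 * e ^+ 2 + k1 * e ^+ 2) * sg); last by ring.
    by rewrite ler_wpM2r// lerD2r.
  rewrite ler_pM2l// in f3.
  have : tau ^+ 2 = 4 * e ^+ 2 by rewrite /e; field.
  have := mulr_ge0 (sqr_ge0 e) s20; nra.
apply: (@le_trans _ _ (1 - 3 * t)); first lra.
apply: (@le_trans _ _ (pr P (~` B))); first by rewrite prC//; lra.
apply: pr_le => //; first exact: measurableC.
by move=> w /good[_ _ /andP[? ?]] /=; lra.
Qed.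

(** The bound [eta] drops to [eta / 4] at each doubling, so the starting index depends on [k]. *)
Lemma balance_iter k (eta tau : R) : 0 < eta -> 0 < tau <= 1 ->
  exists n6 : nat, forall n, (n6 <= n)%N ->
  1 / 2 <= pr P [set w | eta <= kap id n w] ->
  forall i, (i < k)%N -> balanced (2 ^ i * n)%N tau.
Proof.
move=> + tau01; elim: k eta => [|k IH] eta eta0; first by exists 0%N.
have [n1 h1] := balance_step eta tau eta0 tau01.
have [n3 h3] := IH (eta / 4) (divr_gt0 eta0 (ltr0n R 4)).
exists (maxn n1 n3) => n; rewrite geq_max => /andP[nn1 nn3] hk.
have [b1 hk'] := h1 n nn1 hk.
case=> [|i] ik; first by rewrite mul1n.
have := h3 (n + n)%N (leq_trans nn3 (leq_addr _ _)) hk' i ik.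
by rewrite addnn -mul2n mulnA -expnSr.
Qed.

(** The squared gaps of the [S_g ^ 2] sum to at most [kurt] times [(U1 + U2) ^ 2], a scale invariant
    under swaps, so Chebyshev bounds [(U1 - U2) ^ 2] relative to it. *)
Lemma balance_small (tau : R) : 0 < tau <= 1 ->
  (forall eta : R, 0 < eta -> exists n7 : nat, forall n, (n7 <= n)%N ->
     pr P [set w | eta <= kap id n w] < 1 / 2) ->
  exists n8 : nat, forall n, (n8 <= n)%N -> balanced n tau.
Proof.
(* Chebyshev yields [3 t / tau ^+ 2 = 3 tau / 8], and the event of atypical [kurt] adds
   [t <= tau / 8]. *)
move=> /andP[tau0 tau1] hsmall; pose t := tau ^+ 3 / 8.
have t30 : 0 < tau ^+ 3 by rewrite exprn_gt0.
have t0 : 0 < t by rewrite divr_gt0.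
have t3le : tau ^+ 3 <= tau by rewrite -[leRHS]expr1 ler_wiXn2l// ltW.
have tt : t <= tau / 8 by rewrite /t ler_pM2r ?invr_gt0.
have [n5 h5] := kurt_conc t t0; have [n7 h7] := hsmall t t0.
exists (maxn n5 n7) => n; rewrite geq_max => /andP[nn5 nn7].
have [k2 hk2] := h5 (n + n)%N (leq_trans nn5 (leq_addr _ _)).
have hs := h7 (n + n)%N (leq_trans nn7 (leq_addr _ _)).
have mk : measurable [set w | t <= kap id (n + n)%N w] by exact: measurable_le_set.
have mB := measurable_dist id (n + n)%N k2 t.
have k2t : k2 <= 2 * t.
  have [|w /= hw nB] := pr_meet _ _ t mB (measurableC mk) hk2.
    by rewrite prC//; have := tt; lra.
  have : `|kap id (n + n)%N w - k2| <= t by rewrite leNgt; apply/negP.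
  have : kap id (n + n)%N w < t by rewrite ltNge; apply/negP.
  by rewrite ler_distl => ? /andP[? ?]; lra.
pose v (x : nat -> R) := (\sum_(g < n) (x g ^+ 2 + x (n + g)%N ^+ 2)) ^+ 2.
have vE x : v x = (sqsum R n x + sqsum R n (fun i => x (n + i)%N)) ^+ 2.
  by rewrite /v big_split.
have mv : mloc (n + n) v.
  apply: mlocX; apply: mloc_sum => g; apply: mlocD; apply: mlocX; apply: mloc_coord.
    by rewrite ltn_addr.
  by rewrite ltn_add2l.
have msq : measurable_fun [set: R] (fun y : R => y ^+ 2) by exact: exprn_measurable.
have vs (u : {ffun 'I_n -> bool}) x : v (fun i => x (swap n u i)) = v x.
  by rewrite /v (sym_sum_swap n (fun y => y ^+ 2)).
have tau20 : 0 < tau ^+ 2 by rewrite exprn_gt0.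
have t30' : 0 <= 3 * t by rewrite mulr_ge0// ltW.
have gapE := pr_gap_event n P S iidS _ v (3 * t) (tau ^+ 2) msq mv
  (fun x => sqr_ge0 _) vs t30' tau20.
have mE : measurable (ev S id (gap_event n (fun y : R => y ^+ 2) v (3 * t) (tau ^+ 2))).
  by apply: (measurable_ev P S iidS (n + n)); exact: mev_gap_event.
have sub : [set w | tau * (U id n w + U (addn n) n w) < `|U id n w - U (addn n) n w|]
  `<=` ev S id (gap_event n (fun y : R => y ^+ 2) v (3 * t) (tau ^+ 2)) `|`
     [set w | t < `|kap id (n + n)%N w - k2|].
  move=> w /= hw.
  have [hb|hb] := ltP t `|kap id (n + n)%N w - k2|; [by right|left].
  have s1 : 0 <= U id n w + U (addn n) n w by rewrite addr_ge0 ?U_ge0.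
  rewrite /ev /gap_event /= vE; split.
    apply: (@le_trans _ _ (quartsum R (n + n) (fun i => S i w))).
      rewrite quartsumD /quartsum -big_split /=; apply: ler_sum => g _; rewrite /gap.
      have := mulr_ge0 (sqr_ge0 (S g w)) (sqr_ge0 (S (n + g)%N w)).
      by move: (S g w) (S (n + g)%N w) => a b; nra.
    rewrite -kurt_eq sqsumD ler_wpM2r ?sqr_ge0//.
    by move: hb; rewrite ler_distl /rv => /andP[_ h]; apply: (le_trans h); lra.
  rewrite /gap sumrB -[\sum_(i < n) S i w ^+ 2]/(U id n w).
  rewrite -[\sum_(i < n) S (n + i)%N w ^+ 2]/(U (addn n) n w).
  rewrite -exprMn -[ltRHS]real_normK ?num_real// ltrXn2r//.
  by rewrite mulr_ge0// ltW.
have := pr_cover P _ _ _ _ _ (measurable_unbalanced n tau) mE mB sub gapE hk2.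
rewrite /balanced; move/le_trans; apply.
have -> : 3 * t / tau ^+ 2 = 3 / 8 * tau by rewrite /t; field; rewrite gt_eqF.
lra.
Qed.

(** Dichotomy: either [kurt] exceeds some [eta] with probability 1/2 for arbitrarily large [n], or
    it is eventually small. The first case yields balance only from those [n], hence the existential
    form. *)
Lemma balanced_often k (tau : R) m : 0 < tau <= 1 ->
  exists2 n, (m <= n)%N & forall i, (i < k)%N -> balanced (2 ^ i * n)%N tau.
Proof.
move=> tau01.
have [[eta [eta0 hinf]]|hn] := pselect (exists eta : R, 0 < eta /\
    forall m, exists2 n, (m <= n)%N & 1 / 2 <= pr P [set w | eta <= kap id n w]).
  have [n6 h6] := balance_iter k eta tau eta0 tau01.
  have [n nm hk] := hinf (maxn m n6); move: nm; rewrite geq_max => /andP[mn n6n].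
  by exists n => //; exact: h6.
have [|n8 h8] := balance_small tau tau01.
  move=> eta eta0; apply: contrapT => h; apply: hn; exists eta; split=> // m'.
  apply: contrapT => h'; apply: h; exists m' => n m'n.
  by rewrite ltNge; apply/negP => ?; apply: h'; exists n.
exists (maxn m n8); first exact: leq_maxl.
move=> i ik; apply: h8; apply: leq_trans (leq_maxr m n8) _.
by rewrite leq_pmull// expn_gt0.
Qed.

(** Balance of blocks [a] and [b] gives [(1 - tau) (a + b) <= 2 a]; this multiplies over the
    doublings while the exceptional probabilities add up. *)
Lemma U_growth k n (tau : R) : 0 < tau <= 1 ->
  (forall i, (i < k)%N -> balanced (2 ^ i * n)%N tau) ->
  pr P [set w | 2 ^+ k * U id n w < (1 - tau) ^+ k * U id (2 ^ k * n) w] <= k%:R * tau.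
Proof.
move=> /andP[tau0 tau1]; elim: k => [|k IH] hb.
  rewrite mul0r mul1n (_ : [set w | _] = set0) ?/pr ?measure0//.
  by apply/seteqP; split=> // w /=; rewrite !mul1r ltxx.
have mU m f : measurable_fun setT (fun w => f * U id m w) by exact: measurable_funM.
have mk j : measurable [set w | 2 ^+ j * U id n w < (1 - tau) ^+ j * U id (2 ^ j * n) w].
  exact: measurable_lt_set.
have IH' := IH (fun i ik => hb i (leq_trans ik (leqnSn k))).
rewrite -[k.+1%:R]natr1 mulrDl mul1r.
apply: (pr_cover P _ _ _ _ _ (mk k.+1) (mk k) (measurable_unbalanced (2 ^ k * n)%N tau)) => //;
  last exact: hb.
move=> w /=; rewrite double_expn U_double => h.
have [h1|h1] := ltP (2 ^+ k * U id n w) ((1 - tau) ^+ k * U id (2 ^ k * n) w); [by left|right].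
rewrite ltNge; apply/negP; rewrite ler_norml => /andP[h2 _].
move: h; rewrite ltNge => /negP; apply.
have t1 : 0 <= (1 - tau) ^+ k by rewrite exprn_ge0// subr_ge0.
move: h1 h2; move: (U id (2 ^ k * n)%N w) (U (addn _) _ w) (U id n w) => a b u h1 h2.
have h3 : (1 - tau) * (a + b) <= 2 * a by lra.
rewrite exprSr exprS -!mulrA; apply: (@le_trans _ _ ((1 - tau) ^+ k * (2 * a))).
  by rewrite ler_wpM2l.
by rewrite mulrCA ler_wpM2l.
Qed.

(* Balance forces U to grow linearly along the doublings of n, but A^2 grows
   faster: s > 2. *)
Lemma no_concentration : False.
Proof.
have p21 : p2 <= 1.
  apply: (le_trans (lowU _ (leqnn n2))); apply: pr_le1; exact: measurable_le_set.
have [C [n3 C0 hC]] := tightU (p2 / 4) (divr_gt0 p20 (ltr0n R 4)).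
have s20 : 0 < s / 2 by have := s2; lra.
(* The 4 pays for the factor 1/2 in [scal] and for [(1 - tau) ^+ k >= 1/2]. *)
have [k hk] : exists k, 4 * C / c2 < (s / 2) ^+ k.
  have q1 : `|2 / s| < 1.
    rewrite ger0_norm; last by rewrite divr_ge0//; have := s2; lra.
    by rewrite ltr_pdivrMr; have := s2; lra.
  have q0 : 0 < c2 / (4 * C) by rewrite divr_gt0// mulr_gt0.
  have /cvgrPdist_lt/(_ _ q0)[k _ h] := cvg_expr q1.
  exists k; have := h k (leqnn k).
  rewrite /= sub0r normrN ger0_norm; last first.
    by rewrite exprn_ge0// divr_ge0//; have := s2; lra.
  rewrite -ltf_pV2 ?posrE// ?exprn_gt0 ?divr_gt0//; last by have := s2; lra.
  by rewrite -exprVn !invf_div.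
(* The two exceptional events then have total probability at most [p2 / 2], less than that of the
   lower bound on [U]; Bernoulli's inequality also gives [(1 - tau) ^+ k >= 1/2]. *)
pose tau := p2 / (4 * k.+1%:R).
have k0 : 0 < k.+1%:R :> R by rewrite ltr0n.
have tau0 : 0 < tau by rewrite divr_gt0// mulr_gt0.
have ktau : k%:R * tau <= p2 / 4.
  rewrite /tau (_ : k%:R * _ = p2 / 4 * (k%:R / k.+1%:R)); last first.
    by field; rewrite gt_eqF.
  rewrite ler_piMr// ?divr_ge0 ?(ltW p20)// ler_pdivrMr// mul1r.
  by rewrite ler_nat.
have tau1 : tau <= 1.
  rewrite /tau ler_pdivrMr ?mulr_gt0// mul1r; apply: (le_trans p21).
  have : 1 <= k.+1%:R :> R by rewrite ler1n.
  lra.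
have tau01 : 0 < tau <= 1 by rewrite tau0.
have [n5 h5] := scal k.
have [n hn hb] := balanced_often k tau (maxn 1 (maxn n2 (maxn n3 n5))) tau01.
move: hn; rewrite !geq_max => /and4P[n1 nn2 /hC hCn /h5 /andP[hA _]].
have nk : (n2 <= 2 ^ k * n)%N by rewrite (leq_trans nn2)// leq_pmull// expn_gt0.
have hg := U_growth k n tau tau01 hb.
have mU m f : measurable_fun setT (fun w => f * U id m w) by exact: measurable_funM.
have m1 : measurable [set w | c2 * A (2 ^ k * n)%N ^+ 2 <= U id (2 ^ k * n)%N w].
  exact: measurable_le_set.
have m2 : measurable [set w | C * A n ^+ 2 < U id n w] by exact: measurable_lt_set.
have m3 : measurable [set w | 2 ^+ k * U id n w < (1 - tau) ^+ k * U id (2 ^ k * n) w].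
  exact: measurable_lt_set.
have A20 : 0 < A n ^+ 2 by rewrite exprn_gt0// A_gt0.
have ht : 1 / 2 <= (1 - tau) ^+ k.
  have bern j : 1 - j%:R * tau <= (1 - tau) ^+ j.
    elim: j => [|j IH]; first by rewrite mul0r subr0.
    rewrite exprS -[j.+1%:R]natr1; have : 0 <= 1 - tau by rewrite subr_ge0.
    move=> h1; have := ler_wpM2l h1 IH.
    have : 0 <= j%:R * tau * tau by rewrite !mulr_ge0// ltW.
    nra.
  by have := bern k; have := p21; lra.
have sub : [set w | c2 * A (2 ^ k * n)%N ^+ 2 <= U id (2 ^ k * n)%N w] `<=`
    [set w | C * A n ^+ 2 < U id n w] `|`
    [set w | 2 ^+ k * U id n w < (1 - tau) ^+ k * U id (2 ^ k * n) w].
  move=> w /= h; have [h1|h1] := ltP (C * A n ^+ 2) (U id n w); [by left|right].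
  rewrite ltNge; apply/negP => h2.
  have U0 := U_ge0 id (2 ^ k * n)%N w.
  have a1 : 1 / 2 * U id (2 ^ k * n)%N w <= 2 ^+ k * (C * A n ^+ 2).
    apply: (@le_trans _ _ (2 ^+ k * U id n w)); last by rewrite ler_wpM2l// exprn_ge0.
    by apply: le_trans h2; rewrite ler_wpM2r.
  have a2 : c2 * (s ^+ k / 2 * A n ^+ 2) <= U id (2 ^ k * n)%N w.
    by apply: le_trans h; rewrite ler_wpM2l// ltW.
  have a3 : c2 * s ^+ k * A n ^+ 2 <= 4 * C * 2 ^+ k * A n ^+ 2 by nra.
  rewrite ler_pM2r// in a3.
  have : 4 * C / c2 * 2 ^+ k * c2 < (s / 2) ^+ k * 2 ^+ k * c2.
    by rewrite ltr_pM2r// ltr_pM2r ?exprn_gt0.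
  rewrite -exprMn divfK// mulrAC divfK ?gt_eqF//.
  by rewrite [s ^+ k * _]mulrC ltNge a3.
have := pr_cover P _ _ _ _ _ m1 m2 m3 sub hCn (le_trans hg ktau).
move/(le_trans (lowU _ nk)); have := p20; lra.
Qed.

End Concentration.
End Core.

(** * The cluster bootstrap *)

Section Link.
Context {R : realType} {Omega : Type}.
Variables (N : nat -> Omega -> nat) (Y : nat -> nat -> Omega -> R).

Definition csum g w : R := \sum_(i < N g w) Y g i w.
Definition csize g w : R := (N g w)%:R.

Lemma clusterTE G w : clusterT N Y G w =
  tratio R G (csum^~ w) (csize^~ w) (total G (csum^~ w)).
Proof.
rewrite /clusterT /tratio /resid; congr (_ / Num.sqrt _).
apply: eq_bigr => g _; rewrite sumrB sumr_const card_ord natr_sum.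
by rewrite -[_ *+ N g w]mulr_natl.
Qed.

Lemma clusterTstarE G w (b : {ffun 'I_G -> bool}) :
  clusterTstar N Y G (fun g => rad R (b g)) w =
  tratio R G (csum^~ w) (csize^~ w) (sign_sum R G (csum^~ w) b).
Proof.
rewrite /clusterTstar /tratio /resid; congr (_ / Num.sqrt _).
apply: eq_bigr => g _; rewrite sumrB sumr_const card_ord natr_sum exprMn.
rewrite -[_ *+ N g w]mulr_natl (_ : rad R (b g) ^+ 2 = 1) ?mul1r//.
by rewrite /rad; case: (b g); rewrite ?expr1n// sqrrN expr1n.
Qed.

Lemma boot_cdfE G w t : boot_cdf N Y G w t = sign_cdf R G (csum^~ w) (csize^~ w) t.
Proof.
rewrite /boot_cdf /sign_cdf.
by under eq_set do rewrite clusterTstarE.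
Qed.

Hypothesis N_gt0 : forall g w, (0 < N g w)%N.

Lemma csize_ge1 g w : 1 <= csize g w.
Proof. by rewrite ler1n. Qed.

Lemma csize_total_ge G w : G%:R <= \sum_(g < G) csize g w.
Proof.
rewrite -[G in leLHS]card_ord -sum1_card natr_sum.
by apply: ler_sum => g _; exact: csize_ge1.
Qed.

Lemma cv2_ge0 G w : 0 <= cv2 R G (csize^~ w).
Proof. by rewrite divr_ge0 ?sqsum_ge0// sqr_ge0. Qed.

(** The sum of squares is at most the largest size times the total, and the total is at least [G]
    because clusters are nonempty. *)
Lemma cv2_le G w (r : R) : 0 <= r -> (0 < G)%N ->
  (forall g, (g < G)%N -> csize g w <= r * G%:R) -> cv2 R G (csize^~ w) <= r.
Proof.
move=> r0 G0 h; set M := \sum_(g < G) csize g w.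
have MG := csize_total_ge G w; rewrite -/M in MG.
have M0 : 0 < M by apply: lt_le_trans MG; rewrite ltr0n.
rewrite /cv2 -/M ler_pdivrMr ?exprn_gt0//.
apply: (@le_trans _ _ (\sum_(g < G) r * G%:R * csize g w)).
  apply: ler_sum => g _; rewrite expr2 ler_wpM2r ?h//.
rewrite -big_distrr /= -/M -mulrA ler_wpM2l// expr2 ler_wpM2r// ltW//.
Qed.

Lemma cv2_le1 G w : cv2 R G (csize^~ w) <= 1.
Proof.
case: G => [|G].
  by rewrite /cv2 /sqsum !big_ord0 mul0r.
set M := \sum_(g < G.+1) csize g w.
have MG := csize_total_ge G.+1 w; rewrite -/M in MG.
have M0 : 0 < M by apply: lt_le_trans MG; rewrite ltr0n.
rewrite /cv2 -/M ler_pdivrMr ?exprn_gt0// mul1r.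
rewrite expr2 {1}/M big_distrl /=; apply: ler_sum => g _; rewrite expr2.
have c0 h : 0 <= csize h w by exact: le_trans (csize_ge1 h w).
rewrite ler_wpM2l//.
by rewrite /M (bigD1 g) //= lerDl; apply: sumr_ge0 => h _.
Qed.

End Link.

(** * Negligibility of the largest cluster *)

Section Laws.
Context {d : measure_display} {Omega : measurableType d} {R : realType}.
Variables (P : probability Omega R) (N : nat -> Omega -> nat)
  (Y : nat -> nat -> Omega -> R).
Hypothesis N_gt0 : forall g w, (0 < N g w)%N.
Hypothesis iidNY : iid_pairs P (fun g w => ((N g w)%:R, \sum_(i < N g w) Y g i w)).

Local Notation cs := (csum N Y).
Local Notation cn := (@csize R Omega N).

Lemma iid_csum : iid P cs.
Proof.
case: iidNY => mX [ind idl]; split.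
- by move=> g; have := measurableT_comp measurable_snd (mX g).
- move=> J B uJ mB.
  have := ind J (fun j => snd @^-1` B j) uJ.
  by apply=> j; rewrite -[X in measurable X]setTI; exact: measurable_snd.
- move=> g B mB; have := idl g (snd @^-1` B).
  by apply; rewrite -[X in measurable X]setTI; exact: measurable_snd.
Qed.

Lemma measurable_csize g : measurable_fun setT (cn g).
Proof. by case: iidNY => mX _; have := measurableT_comp measurable_fst (mX g). Qed.

Lemma measurable_csum g : measurable_fun setT (cs g).
Proof. by case: iid_csum. Qed.

Lemma csize_law g (x : R) : pr P [set w | x < cn g w] = pr P [set w | x < cn 0%N w].
Proof.
case: iidNY => _ [_ idl]; congr fine.
have := idl g (fst @^-1` [set y | x < y]); apply.
rewrite -[X in measurable X]setTI; apply: measurable_fst => //.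
exact: measurable_lt_set.
Qed.

Hypothesis intN : P.-integrable setT (fun w => (cn 0%N w)%:E).

(* n P(N > r n) <= E[N; N > r n] / r, and E[N] is finite *)
Lemma csize_tail (r delta : R) : 0 < r -> 0 < delta -> exists n0 : nat,
  forall n, (n0 <= n)%N -> n%:R * pr P [set w | r * n%:R < cn 0%N w] <= delta.
Proof.
move=> r0 delta0.
pose E n := [set w | r * n%:R < cn 0%N w].
have mE n : measurable (E n).
  by apply: measurable_lt_set => //; exact: measurable_csize.
pose f n w : \bar R := (cn 0%N w * \1_(E n) w)%:E.
have mf n : measurable_fun setT (f n).
  apply/measurable_EFinP; apply: measurable_funM; first exact: measurable_csize.
  exact: measurable_indic.
have f0 w : setT w -> f n w @[n --> \oo] --> (0%:E : \bar R).
  move=> _; apply: cvg_near_cst; exists (Num.truncn (cn 0%N w / r)).+1 => // n /= hn.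
  rewrite /f indicE memNset ?mulr0// /E /=; apply/negP; rewrite -leNgt.
  rewrite mulrC -ler_pdivrMr//; apply: (@le_trans _ _ (Num.truncn (cn 0%N w / r)).+1%:R).
    by apply: ltW; rewrite truncnS_gt.
  by rewrite ler_nat.
have hcvg : (\int[P]_w f n w)%E @[n --> \oo] --> (\int[P]_w (cst 0%:E w))%E.
  apply: (@dominated_cvg _ _ _ P setT measurableT f (cst 0%:E) (fun w => (cn 0%N w)%:E)) => //.
  move=> n w _; rewrite /f /= lee_fin normrM ger0_norm// ler_piMr//.
  by rewrite indicE; case: (_ \in _); rewrite ?normr1 ?normr0.
rewrite integral0 in hcvg; move/fine_cvgP: hcvg => [_].
move=> /cvgrPdist_le/(_ _ (mulr_gt0 r0 delta0))[n0 _ hn0].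
exists n0 => n nn; have := hn0 n nn; rewrite /= sub0r normrN => h.
have If0 : (0 <= \int[P]_w f n w)%E.
  by apply: integral_ge0 => w _; rewrite lee_fin mulr_ge0.
rewrite -(ler_pM2l r0); apply: le_trans (le_trans (ler_norm _) h).
rewrite -lee_fin fineK; last first.
  rewrite ge0_fin_numE//; apply: (@le_lt_trans _ _ (\int[P]_w (cn 0%N w)%:E)%E).
    apply: ge0_le_integral => //.
    + by move=> w _; rewrite lee_fin mulr_ge0.
    + by apply/measurable_EFinP; exact: measurable_csize.
    + move=> w _; rewrite lee_fin ler_piMr// indicE; case: (_ \in _) => //.
  by have := integrable_fin_num measurableT intN; rewrite ge0_fin_numE//;
    apply: integral_ge0 => w _; rewrite lee_fin.
have PE : P (E n) = (\int[P]_w (\1_(E n) w)%:E)%E by rewrite integral_indic// setIT.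
rewrite -/(E n) mulrA EFinM -(prE P (E n))// PE.
rewrite -ge0_integralZl_EFin//; last first.
- by rewrite mulr_ge0// ltW.
- by apply/measurable_EFinP; exact: measurable_indic.
apply: ge0_le_integral => //.
- by move=> w _; rewrite -EFinM lee_fin !mulr_ge0// ltW.
- apply/measurable_EFinP; apply: measurable_funM => //; exact: measurable_indic.
move=> w _; rewrite -EFinM lee_fin indicE; case: (boolP (w \in E n)) => [|_].
  by rewrite inE /= => /ltW; rewrite !mulr1.
by rewrite !mulr0.
Qed.

Lemma measurable_cv2 n : measurable_fun setT (fun w => cv2 R n (cn^~ w)).
Proof.
apply: measurable_funM.
  by apply: measurable_sum => g; apply: measurable_funX; exact: measurable_csize.
apply: measurable_inv; apply: measurable_funX.
by apply: measurable_sum => g; exact: measurable_csize.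
Qed.

(** Union bound: some size exceeds [r n] with probability at most [n P(N_0 > r n)], which
    [csize_tail] makes small. *)
Lemma cv2_whp (r eta : R) : 0 < r -> 0 < eta -> exists n0 : nat,
  forall n, (n0 <= n)%N -> pr P [set w | r < cv2 R n (cn^~ w)] <= eta.
Proof.
move=> r0 eta0; have [n0 h0] := csize_tail r eta r0 eta0.
exists (maxn 1 n0) => n; rewrite geq_max => /andP[n1 /h0 hn].
pose E (g : nat) := [set w | r * n%:R < cn g w].
have mE g : measurable (E g).
  by apply: measurable_lt_set => //; exact: measurable_csize.
apply: (@le_trans _ _ (pr P (\big[setU/set0]_(g < n) E g))).
  apply: pr_le.
  - by apply: measurable_lt_set => //; exact: measurable_cv2.
  - exact: bigsetU_measurable.
  move=> w /= hw; apply: contrapT => hE; move: hw; apply/negP; rewrite -leNgt.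
  apply: cv2_le => //; first exact: ltW.
  move=> g gn; rewrite leNgt; apply/negP => h; apply: hE.
  by rewrite -(bigcup_mkord n E); exists g.
apply: (le_trans (pr_bigU P n E mE)).
rewrite (eq_bigr (fun=> pr P (E 0%N))); last by move=> g _; exact: csize_law.
by rewrite sumr_const card_ord -mulr_natl.
Qed.

End Laws.

(** * Measurability of the supremum and consequences of consistency *)

Section Consistency.
Context {d : measure_display} {Omega : measurableType d} {R : realType}.
Variables (P : probability Omega R) (N : nat -> Omega -> nat)
  (Y : nat -> nat -> Omega -> R).
Hypothesis iidNY : iid_pairs P (fun g w => ((N g w)%:R, \sum_(i < N g w) Y g i w)).

Local Notation cs := (csum N Y).
Local Notation cn := (@csize R Omega N).

Lemma measurable_tratio G (X : Omega -> R) : measurable_fun setT X ->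
  measurable_fun setT (fun w => tratio R G (cs^~ w) (cn^~ w) (X w)).
Proof.
move=> mX; apply: measurable_funM => //; apply: measurable_inv; apply: measurable_sqrt.
apply: measurable_sum => g; apply: measurable_funX; apply: measurable_funB.
  exact: (measurable_csum P N Y iidNY).
apply: measurable_funM; first exact: (measurable_csize P N Y iidNY).
apply: measurable_funM => //; apply: measurable_inv.
by apply: measurable_sum => h; exact: (measurable_csize P N Y iidNY).
Qed.

Lemma measurable_clusterT G : measurable_fun setT (clusterT N Y G).
Proof.
rewrite (_ : clusterT N Y G =
    fun w => tratio R G (cs^~ w) (cn^~ w) (total G (cs^~ w))); last first.
  by apply/funext => w; rewrite clusterTE.
apply: measurable_tratio; apply: measurable_sum => g.
exact: (measurable_csum P N Y iidNY).
Qed.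

Lemma measurable_boot_cdf G t : measurable_fun setT (fun w => boot_cdf N Y G w t).
Proof.
rewrite (_ : (fun w => _) = (fun w => sign_mean R G (fun b =>
   \1_[set w | tratio R G (cs^~ w) (cn^~ w) (sign_sum R G (cs^~ w) b) <= t] w))); last first.
  apply/funext => w; rewrite boot_cdfE sign_cdfE; congr (_ / _).
  apply: eq_bigr => b _; rewrite indicE; congr ((nat_of_bool _)%:R).
  by apply/idP/idP; rewrite inE.
apply: measurable_funM => //; apply: measurable_sum => b; apply: measurable_indic.
apply: measurable_le_set => //; apply: measurable_tratio.
apply: measurable_sum => g; apply: measurable_funM => //.
exact: (measurable_csum P N Y iidNY).
Qed.

Definition null_cdf G (t : R) : R := fine (P [set w | clusterT N Y G w <= t]).

Lemma null_cdf01 G t : 0 <= null_cdf G t <= 1.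
Proof.
apply/andP; split; first exact: pr_ge0.
by apply: pr_le1; apply: measurable_le_set => //; exact: measurable_clusterT.
Qed.

Lemma null_cdf_right G t : null_cdf G x @[x --> t^'+] --> null_cdf G t.
Proof.
pose X : {RV P >-> R} := mfun_Sub (mem_set (measurable_clusterT G)).
have XE x : cdf X x = P [set w | clusterT N Y G w <= x].
  congr (P _); apply/seteqP; split=> w /=; by rewrite in_itv.
have := @cdf_right_continuous _ _ _ P X t.
have -> : cdf X = EFin \o null_cdf G.
  apply/funext => x; rewrite XE /null_cdf /= fineK// fin_num_measure//.
  by apply: measurable_le_set => //; exact: measurable_clusterT.
by move/fine_cvgP => [].
Qed.

Lemma boot_cdf_right G w t : \forall x \near t^'+, boot_cdf N Y G w x = boot_cdf N Y G w t.
Proof.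
have h : \forall x \near t^'+, forall b : {ffun 'I_G -> bool},
    (tratio R G (cs^~ w) (cn^~ w) (sign_sum R G (cs^~ w) b) <= x) =
    (tratio R G (cs^~ w) (cn^~ w) (sign_sum R G (cs^~ w) b) <= t).
  apply: filter_forall => b; set T := tratio _ _ _ _ _.
  have [hT|hT] := leP T t.
    near=> x; apply: (le_trans hT); near: x; exact: nbhs_right_ge.
  near=> x; apply/negbTE; rewrite -ltNge; near: x; exact: nbhs_right_lt.
near=> x; rewrite !boot_cdfE !sign_cdfE; congr (_ / _); apply: eq_bigr => b _.
by congr ((nat_of_bool _)%:R); move: b; near: x.
Unshelve. all: by end_near. Qed.

Lemma boot_cdf01 G w t : 0 <= boot_cdf N Y G w t <= 1.
Proof.
rewrite boot_cdfE sign_cdfE; apply/andP; split.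
  by rewrite divr_ge0// ?exprn_ge0//; apply: sumr_ge0.
rewrite -[leRHS](sign_mean_cst R G 1); apply: sign_mean_le => b.
by case: (tratio _ _ _ _ _ <= _).
Qed.

Definition bdist G w (t : R) : R := `|boot_cdf N Y G w t - null_cdf G t|.

Lemma sup_bdist_gt G w (eps : R) :
  (eps < sup (range (bdist G w))) <-> exists t, eps < bdist G w t.
Proof.
have hs : has_sup (range (bdist G w)).
  split; first by exists (bdist G w 0), 0.
  exists 1 => _ [t _ <-]; rewrite /bdist ler_norml.
  have := boot_cdf01 G w t; have := null_cdf01 G t; lra.
split=> [h|[t h]].
  by have [_ [t _ <-]] := sup_gt hs.1 h; exists t.
by apply: (lt_le_trans h); apply: sup_upper_bound => //; exists t.
Qed.

(** Both distribution functions are right-continuous in [t], so an excess at [t] persists at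
    rationals just to its right, and a countable union suffices. *)
Lemma measurable_sup_bdist G (eps : R) :
  measurable [set w | eps < sup (range (bdist G w))].
Proof.
rewrite (_ : [set w | _] = \bigcup_(q : rat) [set w | eps < bdist G w (ratr q)]).
  apply: bigcupT_measurable_rat => q; apply: measurable_lt_set => //.
  apply: measurableT_comp => //; apply: measurable_funB => //.
  exact: measurable_boot_cdf.
apply/seteqP; split=> w /=; last by move=> [q _ h]; apply/sup_bdist_gt; exists (ratr q).
move=> /sup_bdist_gt[t ht].
have : \forall x \near t^'+, eps < bdist G w x.
  have h1 : `|boot_cdf N Y G w t - null_cdf G x| @[x --> t^'+] --> bdist G w t.
    by apply: cvg_norm; apply: cvgB; [exact: cvg_cst|exact: null_cdf_right].
  have h2 : \forall x \near t^'+, eps < `|boot_cdf N Y G w t - null_cdf G x|.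
    exact: (cvgr_gt _ h1).
  have h3 := boot_cdf_right G w t.
  near=> x; rewrite /bdist; have -> : boot_cdf N Y G w x = boot_cdf N Y G w t by near: x.
  by near: x.
rewrite /at_right near_withinE => /nbhs_ballP[e /= e0 he].
have [q] : exists q : rat, ratr q \in `]t, t + e[ by apply: rat_in_itvoo; rewrite ltrDl.
rewrite in_itv /= => /andP[q1 q2]; exists q => //=; apply: he => //.
by rewrite /ball /= ler0_norm ?opprB; lra.
Unshelve. all: by end_near. Qed.

Local Notation U := (rv cs (sqsum R) id).
Local Notation W := (rv cs total id).

Hypothesis N_gt0 : forall g w, (0 < N g w)%N.
Hypothesis intN : P.-integrable setT (fun w => (cn 0%N w)%:E).
Hypothesis consistent : forall eps delta : R, 0 < eps -> 0 < delta ->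
  exists n0 : nat, forall n, (n0 <= n)%N ->
  pr P [set w | eps < sup (range (bdist n w))] <= delta.
Hypothesis U_pos : forall eta : R, 0 < eta -> exists n0 : nat, forall n, (n0 <= n)%N ->
  pr P [set w | U n w <= 0] <= eta.

Lemma good_event (eps r eta : R) : 0 < eps -> 0 < r -> 0 < eta ->
  exists n0 : nat, forall n, (n0 <= n)%N -> exists B : set Omega,
    [/\ measurable B, pr P B <= eta & forall w, ~ B w ->
      [/\ forall t, bdist n w t <= eps, 0 <= cv2 R n (cn^~ w) <= r & 0 < U n w]].
Proof.
move=> eps0 r0 eta0; have eta3 : 0 < eta / 3 by rewrite divr_gt0.
have [n1 h1] := consistent eps (eta / 3) eps0 eta3.
have [n2 h2] := cv2_whp P N Y N_gt0 iidNY intN r (eta / 3) r0 eta3.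
have [n3 h3] := U_pos (eta / 3) eta3.
exists (maxn n1 (maxn n2 n3)) => n; rewrite !geq_max => /and3P[/h1{}h1 /h2{}h2 /h3{}h3].
have mU := measurable_rv_sqsum P cs (iid_csum P N Y iidNY) id n.
have m1 := measurable_sup_bdist n eps.
have m2 : measurable [set w | r < cv2 R n (cn^~ w)].
  by apply: measurable_lt_set => //; exact: (measurable_cv2 P N Y iidNY).
have m3 : measurable [set w | U n w <= 0] by exact: measurable_le_set.
have m23 := measurableU _ _ m2 m3; have m123 := measurableU _ _ m1 m23.
exists ([set w | eps < sup (range (bdist n w))] `|`
  ([set w | r < cv2 R n (cn^~ w)] `|` [set w | U n w <= 0])); split=> //.
  have := prU P _ _ m1 m23; have := prU P _ _ m2 m3; lra.
move=> w nB; split.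
- move=> t; rewrite leNgt; apply/negP => h; apply: nB; left => /=.
  by apply/sup_bdist_gt; exists t.
- rewrite cv2_ge0 /= leNgt; apply/negP => h; apply: nB; by right; left.
- by rewrite ltNge; apply/negP => h; apply: nB; right; right.
Qed.

Lemma pr_lt1_ex (B : set Omega) : measurable B -> pr P B < 1 -> exists w, ~ B w.
Proof.
move=> mB h; apply: (pr_neq0 P (~` B)); rewrite prC//; lra.
Qed.

(** At any two good points the bootstrap laws are close to the same nonrandom law, hence to each
    other, and [kurt_close] applies. The constant [k] is the value at an arbitrary good point. *)
Lemma kurt_concentrates (tau : R) : 0 < tau -> exists n0 : nat, forall n, (n0 <= n)%N ->
  exists k : R, pr P [set w | tau < `|rv cs (kurt R) id n w - k|] <= tau.
Proof.
move=> tau0; have [eps [r [eps0 r0 close]]] := kurt_close R tau tau0.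
pose eta := Num.min tau (1 / 2).
have eta0 : 0 < eta by rewrite lt_min tau0 /=; lra.
have eta1 : eta < 1 by rewrite gt_min; apply/orP; right; lra.
have [n0 h0] := good_event (eps / 2) r eta (divr_gt0 eps0 (ltr0n R 2)) r0 eta0.
exists n0 => n /h0 [B [mB hB good]].
have [w0 nB0] := pr_lt1_ex B mB (le_lt_trans hB eta1).
have [d0 c0 u0] := good w0 nB0.
exists (rv cs (kurt R) id n w0); apply: (@le_trans _ _ eta); last by rewrite ge_min lexx.
apply: le_trans hB; apply: pr_le => //.
  apply: measurable_lt_set => //; apply: measurableT_comp => //; apply: measurable_funB => //.
  exact: (measurable_rv_kurt P cs (iid_csum P N Y iidNY)).
move=> w /= hw; apply: contrapT => nB; have [d1 c1 u1] := good w nB.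
move: hw; apply/negP; rewrite -leNgt; apply: (close _ _ _ _ _ _ u1 u0 c1 c0) => t.
rewrite -!boot_cdfE; have := d0 t; have := d1 t; rewrite /bdist !ler_norml; lra.
Qed.

(** The hypothesis gives [V <= 9 W^2], and [U <= 2 V + 2 cv2 W^2] with [cv2 <= 1] gives 18 + 2 = 20.
    A zero denominator is excluded, since the quotient would then be 0. *)
Lemma sqsum_le_total n w : 1 / 9 <= clusterT N Y n w ^+ 2 ->
  U n w <= 20 * W n w ^+ 2.
Proof.
rewrite clusterTE tratio_sqr; set V := resid _ _ _ _ _ => h.
have V0 : 0 < V.
  rewrite lt_neqAle resid_ge0 andbT; apply/eqP => V0.
  by move: h; rewrite -V0 invr0 mulr0; lra.
rewrite ler_pdivlMr// in h.
have := sqsum_le_resid R n (cs^~ w) (cn^~ w) (total n (cs^~ w)).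
rewrite -/V /rv => h2; apply: (le_trans h2).
have c1 : cv2 R n (cn^~ w) <= 1 by exact: cv2_le1.
have := ler_wpM2r (sqr_ge0 (total n (cs^~ w))) c1; lra.
Qed.

Variables (A D : nat -> R).
Hypothesis tightW : forall eta : R, 0 < eta -> exists K : R, exists2 n0 : nat, 0 < K &
  forall n, (n0 <= n)%N -> pr P [set w | K * A n < `|W n w - D n|] <= eta.

(** By consistency the null law inherits mass 1/20 beyond -1/3 and beyond 1/3 from the bootstrap
    tails of mass 1/10; [tightW] removes at most 1/40 of it. *)
Lemma U_upper : exists C1 p1 : R, exists n1 : nat, [/\ 0 < C1, 0 < p1 &
  forall n, (n1 <= n)%N -> p1 <= pr P [set w | U n w <= C1 * A n ^+ 2]].
Proof.
have h40 : 0 < 1 / 40 :> R by lra.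
have [K [n0 K0 hK]] := tightW (1 / 40) h40.
have h20 : 0 < 1 / 20 :> R by lra.
have h324 : 0 < 1 / 324 :> R by lra.
have h2 : 0 < 1 / 2 :> R by lra.
have [n1 h1] := good_event (1 / 20) (1 / 324) (1 / 2) h20 h324 h2.
exists (20 * K ^+ 2), (1 / 40), (maxn n0 n1); split=> //.
  by rewrite mulr_gt0// exprn_gt0.
move=> n; rewrite geq_max => /andP[/hK{}hK /h1 [B [mB hB good]]].
have hB1 : pr P B < 1 by lra.
have [w0 nB0] := pr_lt1_ex B mB hB1.
have [d0 c0 u0] := good w0 nB0.
have [t1 t2] := sign_cdf_tails R n (cs^~ w0) (cn^~ w0) u0 c0.
rewrite -!boot_cdfE in t1 t2.
have f1 : 1 / 20 <= null_cdf n (- (1 / 3)).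
  by have := d0 (- (1 / 3)); rewrite /bdist ler_norml; lra.
have f2 : null_cdf n (1 / 3) <= 19 / 20.
  by have := d0 (1 / 3); rewrite /bdist ler_norml; lra.
have mT := measurable_clusterT n.
have mU := measurable_rv_sqsum P cs (iid_csum P N Y iidNY) id n.
have mW := measurable_rv_total P cs (iid_csum P N Y iidNY) id n.
have m1 : measurable [set w | clusterT N Y n w <= - (1 / 3)] by exact: measurable_le_set.
have m2 : measurable [set w | clusterT N Y n w <= 1 / 3] by exact: measurable_le_set.
have mE : measurable [set w | U n w <= 20 * K ^+ 2 * A n ^+ 2] by exact: measurable_le_set.
have mKW : measurable [set w | K * A n < `|W n w - D n|].
  by apply: measurable_lt_set => //; apply: measurableT_comp => //; exact: measurable_funB.
have hsgn w : (clusterT N Y n w <= - (1 / 3) -> W n w <= 0) /\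
    (1 / 3 < clusterT N Y n w -> 0 <= W n w).
  rewrite clusterTE /tratio /rv; set x := total _ _; set y := Num.sqrt _.
  have y0 : 0 <= y^-1 by rewrite invr_ge0 sqrtr_ge0.
  split=> h; rewrite leNgt; apply/negP => hx.
    have := mulr_ge0 (ltW hx) y0; lra.
  have := mulr_le0_ge0 (ltW hx) y0; lra.
have fin w : 1 / 9 <= clusterT N Y n w ^+ 2 -> W n w ^+ 2 <= (K * A n) ^+ 2 ->
    U n w <= 20 * K ^+ 2 * A n ^+ 2.
  move=> /sqsum_le_total h h'; rewrite exprMn in h'; lra.
(* In the tail opposite to the sign of [D n], [|W| <= |W - D n| <= K A n] off the exceptional event,
   so the unknown centring drops out. *)
have [D0|D0] := leP 0 (D n).
  have sub : [set w | clusterT N Y n w <= - (1 / 3)] `<=`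
      [set w | U n w <= 20 * K ^+ 2 * A n ^+ 2] `|` [set w | K * A n < `|W n w - D n|].
    move=> w /= hw; have [h|h] := ltP (K * A n) `|W n w - D n|; [by right|left].
    have W0 := (hsgn w).1 hw.
    apply: fin; first by nra.
    rewrite -sqrrN; apply: sqr_le; first lra.
    by move: h; rewrite ler_norml; lra.
  have := pr_cover P _ _ _ _ _ m1 mE mKW sub (lexx _) hK.
  by rewrite /null_cdf in f1; rewrite /pr in f1 *; lra.
have sub : ~` [set w | clusterT N Y n w <= 1 / 3] `<=`
    [set w | U n w <= 20 * K ^+ 2 * A n ^+ 2] `|` [set w | K * A n < `|W n w - D n|].
  move=> w /= /negP; rewrite -ltNge => hw.
  have [h|h] := ltP (K * A n) `|W n w - D n|; [by right|left].
  have W0 := (hsgn w).2 hw.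
  apply: fin; first by nra.
  apply: sqr_le => //.
  by move: h; rewrite ler_norml; lra.
have := pr_cover P _ _ _ _ _ (measurableC m2) mE mKW sub (lexx _) hK.
by rewrite prC//; rewrite /null_cdf in f2; rewrite /pr in f2 *; lra.
Qed.

End Consistency.

(** * Domains of attraction *)

Section DistributionFunction.
Context {R : realType}.
Variable F : R -> R.
Hypothesis dF : distribution_function F.

(** A monotone function has countably many discontinuities, while the interval has positive Lebesgue
    measure. Convergence in distribution speaks only about such points. *)
Lemma continuity_point (a b : R) : a < b -> exists2 x, a < x < b & {for x, continuous F}.
Proof.
move=> ab; case: dF => ndF [rcF _].
apply: contrapT => hn.
have hdis x : a < x < b -> discontinuity F x.
  move=> xab; have cr : cvg (F y @[y --> x^'+]) by apply/cvg_ex; exists (F x); exact: rcF.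
  have cl : cvg (F y @[y --> x^'-]).
    apply: nondecreasing_at_left_is_cvgr; near=> y.
      by move=> u v _ _; exact: ndF.
    by exists (F x) => _ [u /= + <-]; rewrite in_itv /= => /andP[_ /ltW]; exact: ndF.
  split=> //; apply/eqP => e; apply: hn; exists x => //.
  apply/left_right_continuousP; split; last exact: rcF.
  have <- : lim (F y @[y --> x^'+]) = F x by apply/cvg_lim => //; exact: rcF.
  by rewrite -e.
have hab : {in `[a, b] &, nondecreasing_fun F} by move=> u v _ _; exact: ndF.
have hc : countable [set` `]a, b[].
  apply: sub_countable (discontinuity_countable hab); apply: subset_card_le => x /= xab.
  by split => //; apply: hdis; move: xab; rewrite in_itv.
have := countable_lebesgue_measure0 hc; rewrite lebesgue_measure_itv /= lte_fin ab.
move=> /eqP; rewrite -EFinD eqe subr_eq0 => /eqP ba; move: ab; by rewrite ba ltxx.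
Unshelve. all: by end_near. Qed.

End DistributionFunction.

Section DomainOfAttraction.
Context {d : measure_display} {Omega : measurableType d} {R : realType}.
Variables (P : probability Omega R) (S : nat -> Omega -> R).
Hypothesis iidS : iid P S.
Variables (A D : nat -> R) (F : R -> R).
Hypothesis A_gt0 : forall n, (0 < n)%N -> 0 < A n.
Hypothesis dF : distribution_function F.
Hypothesis cvgF :
  cvg_in_distribution P (fun n w => (\sum_(g < n) S g w - D n) / A n) F.

Local Notation W := (rv S total id).

Lemma cdf_cvg (x delta : R) : {for x, continuous F} -> 0 < delta ->
  exists n0 : nat, forall n, (n0 <= n)%N ->
  F x - delta <= pr P [set w | W n w <= D n + x * A n] <= F x + delta.
Proof.
move=> cx delta0; have /cvgrPdist_le/(_ _ delta0)[n0 _ h] := cvgF x cx.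
exists (maxn 1 n0) => n; rewrite geq_max => /andP[n1 /h] /=.
have An := A_gt0 n n1.
have -> : [set w | (\sum_(g < n) S g w - D n) / A n <= x] = [set w | W n w <= D n + x * A n].
  by apply/seteqP; split=> w /=; rewrite ler_pdivrMr// lerBlDl.
rewrite -/(pr P _) ler_norml; lra.
Qed.

Let mle n (x : R) : measurable [set w | W n w <= x].
Proof. by apply: measurable_le_set => //; exact: (measurable_rv_total P S iidS). Qed.

(** Right continuity extends [F < 1] from [x] to some [z > x]; two continuity points between them,
    where [F] lies strictly between 0 and 1, serve as [y1] and [y2]. *)
Lemma two_sided : nondegenerate F -> exists y1 y2 p : R, exists n0 : nat,
  [/\ y1 < y2, 0 < p,
   forall n, (n0 <= n)%N -> p <= pr P [set w | W n w <= D n + y1 * A n] &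
   forall n, (n0 <= n)%N -> p <= pr P [set w | D n + y2 * A n < W n w]].
Proof.
move=> [x /andP[x0 x1]]; case: (dF) => ndF [rcF _].
have [z xz z1] : exists2 z, x < z & F z < 1.
  near x^'+ => y; exists y; near: y; first exact: nbhs_right_gt.
  exact: (cvgr_lt _ (rcF x)).
have [y1 /andP[a1 a2] c1] := continuity_point F dF x ((x + z) / 2) (ltac:(lra)).
have [y2 /andP[b1 b2] c2] := continuity_point F dF ((x + z) / 2) z (ltac:(lra)).
have f1 : F x <= F y1 by apply: ndF; exact: ltW.
have f2 : F y2 <= F z by apply: ndF; exact: ltW.
pose p := Num.min (F y1) (1 - F y2) / 2.
have p0 : 0 < p by rewrite divr_gt0// lt_min; apply/andP; split; lra.
have p1 : p <= F y1 / 2 by rewrite /p ler_pM2r// ge_min lexx.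
have p2 : p <= (1 - F y2) / 2 by rewrite /p ler_pM2r// ge_min lexx orbT.
have [n1 h1] := cdf_cvg y1 p c1 p0.
have [n2 h2] := cdf_cvg y2 p c2 p0.
exists y1, y2, p, (maxn n1 n2); split=> //.
- exact: lt_trans b1.
- by move=> n; rewrite geq_max => /andP[/h1 ? _]; lra.
- move=> n; rewrite geq_max => /andP[_ /h2 h].
  rewrite (_ : [set w | _] = ~` [set w | W n w <= D n + y2 * A n]); last first.
    by apply/seteqP; split=> w /=; rewrite ltNge => /negP.
  by rewrite prC//; lra.
Unshelve. all: by end_near. Qed.

Lemma tight_total (eta : R) : 0 < eta -> exists K : R, exists2 n0 : nat, 0 < K &
  forall n, (n0 <= n)%N -> pr P [set w | K * A n < `|W n w - D n|] <= eta.
Proof.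
move=> eta0; have e4 : 0 < eta / 4 by rewrite divr_gt0.
case: (dF) => ndF [_ [F0 F1]].
have [x1 c1 h1] : exists2 x, {for x, continuous F} & F x <= eta / 4.
  have /filter_ex[y hy] : \forall y \near -oo, F y <= eta / 4 by exact: (cvgr_le _ F0).
  have [x /andP[_ xy] cx] := continuity_point F dF (y - 1) y (ltac:(lra)).
  by exists x => //; apply: le_trans hy; apply: ndF; exact: ltW.
have [x2 c2 h2] : exists2 x, {for x, continuous F} & 1 - eta / 4 <= F x.
  have /filter_ex[y hy] : \forall y \near +oo, 1 - eta / 4 <= F y.
    by apply: (cvgr_ge _ F1); lra.
  have [x /andP[yx _] cx] := continuity_point F dF y (y + 1) (ltac:(lra)).
  by exists x => //; apply: (le_trans hy); apply: ndF; exact: ltW.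
have [n1 k1] := cdf_cvg x1 (eta / 4) c1 e4.
have [n2 k2] := cdf_cvg x2 (eta / 4) c2 e4.
pose K := `|x1| + `|x2| + 1.
have K0 : 0 < K by rewrite ltr_wpDl// addr_ge0.
exists K, (maxn 1 (maxn n1 n2)) => // n; rewrite !geq_max => /and3P[n0 /k1{}k1 /k2{}k2].
have An := A_gt0 n n0.
have m2 := measurableC (mle n (D n + x2 * A n)).
apply: (@le_trans _ _ (eta / 2 + eta / 2)); last lra.
apply: (pr_cover P _ _ _ _ _ _ (mle n (D n + x1 * A n)) m2).
- apply: measurable_lt_set => //; apply: measurableT_comp => //; apply: measurable_funB => //.
  exact: (measurable_rv_total P S iidS).
- move=> w /=; rewrite ltr_normr => /orP[h|h]; [right|left => /=].
    apply/negP; rewrite -ltNge -ltrBrDl; apply: le_lt_trans h.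
    by rewrite ler_wpM2r ?(ltW An)//; have := ler_norm x2; have := normr_ge0 x1; rewrite /K; lra.
  have : - x1 * A n <= K * A n.
    rewrite ler_wpM2r ?(ltW An)//.
    by have := ler_norm (- x1); rewrite normrN; have := normr_ge0 x2; rewrite /K; lra.
  lra.
- lra.
- by rewrite prC//; lra.
Qed.

End DomainOfAttraction.

(** This is where [alpha < 2] enters: the value is [2 ^ (2 / alpha)], which would be exactly 2 for
    [alpha = 2], and linear growth of [U] would then be no contradiction. *)
Lemma scaling_gt2 (R : realType) (alpha : R) : 1 < alpha < 2 -> 2 < (2 `^ alpha^-1) ^+ 2 :> R.
Proof.
move=> /andP[a1 a2]; have a0 : 0 < alpha by lra.
rewrite -powR_mulrn ?powR_ge0// -powRrM.
have r0 : 0 < alpha^-1 * 2 - 1 by rewrite subr_gt0 mulrC ltr_pdivlMr// mul1r.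
have := gt0_ltr_powR r0 _ _ (ltr1n R 2).
rewrite !nnegrE powR1 ler01 ler0n => /(_ isT isT) h.
have e : 2 `^ (1 + (alpha^-1 * 2 - 1)) = 2 * 2 `^ (alpha^-1 * 2 - 1) :> R.
  by rewrite powRD ?powRr1//; apply/implyP => _; rewrite pnatr_eq0.
rewrite (_ : alpha^-1 * 2 = 1 + (alpha^-1 * 2 - 1)); last by ring.
by rewrite e; lra.
Qed.

(** Slow variation at the single factor [2 ^+ k]: [A (2 ^ k * n)] is [2 ^ (k / alpha) A n] times a
    ratio [rho] tending to 1. *)
Lemma norming_scaling (R : realType) (alpha : R) (A : nat -> R) (L : R -> R) :
  slowly_varying L ->
  (forall n, (0 < n)%N -> 0 < A n /\ A n = n%:R `^ alpha^-1 * L n%:R) ->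
  forall k, exists n1 : nat, forall n, (n1 <= n)%N ->
  ((2 `^ alpha^-1) ^+ 2) ^+ k / 2 * A n ^+ 2 <= A (2 ^ k * n)%N ^+ 2 <=
    2 * ((2 `^ alpha^-1) ^+ 2) ^+ k * A n ^+ 2.
Proof.
move=> [_ [_ sv]] hA k; have k0 : 0 < 2 ^+ k :> R by rewrite exprn_gt0.
(* If [rho] is within 1/4 of 1, its square lies between 9/16 and 25/16, hence between 1/2 and 2. *)
have q0 : 0 < 1 / 4 :> R by lra.
have hs := sv (2 ^+ k) k0.
have /cvgrPdist_le/(_ _ q0)[n1 _ h] : (fun n : nat => L (2 ^+ k * n%:R) / L n%:R) @ \oo --> (1 : R).
  by apply: (cvg_comp _ _ _ hs); exact: cvgr_idn.
exists (maxn 1 n1) => n; rewrite geq_max => /andP[n0 /h] /=.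
have [An AE] := hA n n0.
have nk0 : (0 < 2 ^ k * n)%N by rewrite muln_gt0 expn_gt0.
have [_ AkE] := hA _ nk0.
have Ln : L n%:R != 0.
  by apply/eqP => L0; move: An; rewrite AE L0 mulr0 ltxx.
set rho := L (2 ^+ k * n%:R) / L n%:R => hr.
have e : A (2 ^ k * n)%N = (2 `^ alpha^-1) ^+ k * A n * rho.
  rewrite AkE AE natrM natrX powRM ?exprn_ge0//.
  have -> : (2 ^+ k) `^ alpha^-1 = (2 `^ alpha^-1) ^+ k :> R.
    by rewrite -powR_mulrn// -powRrM mulrC powRrM powR_mulrn// powR_ge0.
  rewrite /rho; move: Ln; move: (L (_ * _)) (L n%:R) (n%:R `^ _) => l1 l2 m l20.
  by field.
have B0 : 0 <= ((2 `^ alpha^-1) ^+ k * A n) ^+ 2 by exact: sqr_ge0.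
have sE : ((2 `^ alpha^-1) ^+ 2) ^+ k = ((2 `^ alpha^-1) ^+ k) ^+ 2 :> R.
  by rewrite -!exprM mulnC.
rewrite sE e [(_ * rho) ^+ 2]exprMn.
have -> : ((2 `^ alpha^-1) ^+ k) ^+ 2 / 2 * A n ^+ 2 =
   ((2 `^ alpha^-1) ^+ k * A n) ^+ 2 * (1 / 2) by field.
have -> : 2 * ((2 `^ alpha^-1) ^+ k) ^+ 2 * A n ^+ 2 =
   ((2 `^ alpha^-1) ^+ k * A n) ^+ 2 * 2 by ring.
move: hr; rewrite ler_norml => /andP[r1 r2].
by apply/andP; split; apply: ler_wpM2l => //; nra.
Qed.

Theorem theoremA2 (R : realType) (d : measure_display) (Omega : measurableType d)
  (P : probability Omega R) (N : nat -> Omega -> nat)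
  (Y : nat -> nat -> Omega -> R) (c alpha : R) :
  (forall g w, (0 < N g w)%N) ->
  iid_pairs P (fun g w => ((N g w)%:R, \sum_(i < N g w) Y g i w)) ->
  (forall g, P.-integrable setT (fun w => ((N g w)%:R : R)%:E)) ->
  (forall g, ('E_P[fun w => ((N g w)%:R)%R] = c%:E)%E) -> 0 < c ->
  (forall g, P.-integrable setT (fun w => (\sum_(i < N g w) Y g i w)%:E)) ->
  (forall g, ('E_P[fun w => (\sum_(i < N g w) Y g i w)%R] = (0:R)%:E)%E) ->
  1 < alpha < 2 ->
  stable_DOA P (fun g w => (N g w)%:R) alpha ->
  stable_DOA P (fun g w => \sum_(i < N g w) Y g i w) alpha ->
  ~ (forall eps : R, 0 < eps ->
       (fun G => P [set w | eps < sup (range (fun t : R =>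
            `| boot_cdf N Y G w t - fine (P [set w' | clusterT N Y G w' <= t]) |))])
       @ \oo --> (0:R)%:E).
Proof.
move=> N_gt0 iidNY intN _ _ _ _ alpha12 _ [_ [A [D [L [F [sv [hA [dF [nd cvgF]]]]]]]]] cons.
have iidS := iid_csum P N Y iidNY.
have A_gt0 n : (0 < n)%N -> 0 < A n by move=> /hA[].
have consistent (eps delta : R) : 0 < eps -> 0 < delta ->
    exists n0 : nat, forall n, (n0 <= n)%N ->
    pr P [set w | eps < sup (range (bdist P N Y n w))] <= delta.
  move=> eps0 delta0; have /fine_cvgP[_] := cons eps eps0.
  move=> /cvgrPdist_le/(_ _ delta0)[n0 _ h]; exists n0 => n /h /=.
  by rewrite sub0r normrN => /(le_trans (ler_norm _)).
have [y1 [y2 [p [n0 [y12 p0 low high]]]]] := two_sided P _ iidS A D F A_gt0 dF cvgF nd.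
have [c2 [p2 [n2 [c20 p20 lowU]]]] := U_lower P _ iidS A D A_gt0 y1 y2 p n0 y12 p0 low high.
have U_pos := U_gt0_whp P _ iidS A A_gt0 c2 p2 n2 c20 p20 lowU.
have conc := kurt_concentrates P N Y iidNY N_gt0 (intN 0%N) consistent U_pos.
have tightW := tight_total P _ iidS A D F A_gt0 dF cvgF.
have [C1 [p1 [n1 [C10 p10 upU]]]] :=
  U_upper P N Y iidNY N_gt0 (intN 0%N) consistent U_pos A D tightW.
have s2 := scaling_gt2 R alpha alpha12.
have scal := norming_scaling R alpha A L sv hA.
have tightU := U_tight P _ iidS A _ s2 scal C1 p1 n1 C10 p10 upU.
exact: (no_concentration P _ iidS A A_gt0 c2 p2 n2 c20 p20 lowU _ s2 scal tightU conc).
Qed.
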